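(* Let $k>1$ be an integer and let $C>0$ be a constant. Then there exists $\rho>0$, depending only on $C$ (for the fixed dimension $k$), such that for every holomorphic map $\Phi:\mathbb{B}^k\to\mathbb{C}^k$ with $\Phi(0)=0$, $\Phi'(0)=\mathrm{Id}$, with $\Phi'(z)$ invertible for all $z\in\mathbb{B}^k$ and $$\|\Phi'(z)\|\cdot\|\Phi'(z)^{-1}\|\le C\qquad\text{for all } z\in\mathbb{B}^k,$$ the image $\Phi(\mathbb{B}^k)$ contains a ball $B(a,\rho)$ of radius $\rho$ for some $a\in\mathbb{C}^k$, and there exists a domain $U\subset\mathbb{B}^k$ such that $\Phi(U)=B(a,\rho)$.
   Context: $\mathbb{B}^k$ is the open unit ball of $\mathbb{C}^k$ for the Euclidean norm, and $B(a,\rho)$ is the open Euclidean ball in $\mathbb{C}^k$ with center $a$ and radius $\rho$. $\Phi'(z)$ denotes the complex Jacobian matrix of $\Phi$ at $z$, $\mathrm{Id}$ is the identity matrix, and $\|\cdot\|$ is the operator norm on $k\times k$ complex matrices. A domain is a nonempty connected open set. *)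

(* Defs.v *)
From HB Require Import structures.
From mathcomp Require Import all_boot all_order all_algebra.
From mathcomp Require Import complex.
From mathcomp Require Import all_classical all_reals all_analysis.
Import numFieldNormedType.Exports.
Set Implicit Arguments.
Unset Strict Implicit.
Unset Printing Implicit Defensive.
Import Order.TTheory GRing.Theory Num.Theory.
Local Open Scope classical_set_scope.
Local Open Scope ring_scope.

HB.instance Definition _ (R : realType) := NormedModule.copy R[i] R[i]^o.

(* Points of C^k are row vectors, as required by the library's Jacobian ['J].
   The library norm on ['rV_k] is the sup norm; it only provides the topology
   and differentiability, which do not depend on the choice of norm. *)
Definition eucl_norm (R : realType) (k : nat) (v : 'rV[R[i]]_k) : R :=
  Num.sqrt (\sum_(j < k) ComplexField.Normc.normc (v 0 j) ^+ 2).

Definition eucl_ball (R : realType) (k : nat) (a : 'rV[R[i]]_k) (r : R) :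
    set 'rV[R[i]]_k :=
  [set z | eucl_norm (z - a) < r].

(* ['J f z] is the transpose of the usual Jacobian matrix f'(z): the complex
   differential at z is h |-> h *m 'J f z, that is h^T |-> f'(z) *m h^T.  The
   operator norm is therefore taken for the right action on row vectors, so
   that [op_norm ('J f z)] is the operator norm of f'(z), and
   [op_norm (invmx ('J f z))] that of its inverse. *)
Definition op_norm (R : realType) (k : nat) (M : 'M[R[i]]_k) : R :=
  sup [set eucl_norm (v *m M) | v in [set v | eucl_norm v <= 1]].

Lemma op_norm_has_sup (R : realType) (k : nat) (M : 'M[R[i]]_k) :
  has_sup [set eucl_norm (v *m M) | v in [set v | eucl_norm v <= 1]].
Proof.
pose nc := @ComplexField.Normc.normc R.
have nc0 x : 0 <= nc x by case: x => a b; exact: sqrtr_ge0.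
have nc00 : nc 0 = 0 by exact: ComplexField.Normc.normc0.
split.
  exists (eucl_norm (0 *m M)), 0 => //=.
  rewrite /eucl_norm big1 ?sqrtr0 ?ler01 // => j _.
  by rewrite mxE -/(nc 0) nc00 expr0n.
exists (Num.sqrt (\sum_(j < k) (\sum_(i < k) nc (M i j)) ^+ 2)).
move=> _ [v /= v1 <-]; rewrite ler_wsqrtr //; apply: ler_sum => j _.
rewrite ler_sqr ?nnegrE ?nc0 ?sumr_ge0 // mxE.
have vi i : nc (v 0 i) <= 1.
  apply: le_trans v1; rewrite -[leLHS](ger0_norm (nc0 _)) -sqrtr_sqr /eucl_norm.
  rewrite ler_wsqrtr // (bigD1 i) //= lerDl sumr_ge0 // => l _.
  exact: sqr_ge0.
apply: (@le_trans _ _ (\sum_(i < k) nc (v 0 i * M i j))).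
  elim/big_ind2 : _ => [|x1 x2 y1 y2 h1 h2|//]; first by rewrite -/(nc 0) nc00.
  exact: le_trans (le_normcD _ _) (lerD h1 h2).
apply: ler_sum => i _.
by rewrite /nc ComplexField.Normc.normcM ler_piMl.
Qed.

(* [differentiable] is over the scalar field R[i]: the differential is
   C-linear. *)
Definition holomorphic_on (R : realType) (k : nat) (D : set 'rV[R[i]]_k)
    (f : 'rV[R[i]]_k -> 'rV[R[i]]_k) : Prop :=
  forall z, D z -> differentiable f z.

Definition domain (T : topologicalType) (U : set T) : Prop :=
  [/\ U !=set0, open U & connected U].

(* Main.v *)
Require Import Defs.
From HB Require Import structures.
From mathcomp Require Import all_boot all_order all_algebra.
From mathcomp Require Import complex.
From mathcomp Require Import all_classical all_reals all_analysis.
From mathcomp Require Import ring lra.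
Import numFieldNormedType.Exports.
Set Implicit Arguments.
Unset Strict Implicit.
Unset Printing Implicit Defensive.
Import Order.TTheory GRing.Theory Num.Theory.
Local Open Scope classical_set_scope.
Local Open Scope ring_scope.

(** The proof is the classical one for Bloch's theorem: choose a ball on which
    the derivative has at most twice the norm that it has at the centre,
    deduce from Cauchy's estimates that the derivative is nearly constant on a
    definite fraction of that ball, and invert the map there. Write [N z] for
    the operator norm of the derivative.

    _Choice of the ball_ ([derivative_doubling_ball]). There are [a] and [r]
    with [r * N a >= 1/4] and [N <= 2 N a] on the ball of radius [r] around
    [a]. Otherwise one could jump from the origin, along steps of lengths
    [1/4], [1/8], and so on, to points where [N] exceeds [2], [4], and so on;
    the limit of these points lies in the unit ball, where [N] is locally
    bounded by Cauchy's estimate.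

    _Almost constant derivative_ ([derivative_lipschitz]). The difference
    quotients of the map in a direction [v] are holomorphic and bounded by [2
    N a] times the norm of [v], hence Lipschitz with a constant of order [N a
    / r]; in the limit so is the derivative.

    _Inversion_. The distortion hypothesis bounds the inverse of the
    derivative at [a] by [C / N a]. Hence, on the ball of radius [tau * r]
    with [tau] depending only on [k] and [C], the Newton map with derivative
    frozen at [a] is a contraction by one half ([newton_contraction]). So the
    map is injective there with Lipschitz inverse ([inverse_lipschitz]), and
    its image contains a ball whose radius is of order [tau * r * N a / C],
    which is at least a multiple of [tau / C] ([newton_surjective]). The set
    [U] is the preimage of that ball; it is connected as the image of a ball
    under a continuous map ([connected_preimage]).

    Holomorphy is only differentiability at every point, so Cauchy's estimate
    ([cauchy_estimate]) has to come from Goursat's theorem ([goursat]). That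
    theorem is proved by bisection for real closed forms [P dx + Q dy] with
    differentiable coefficients, and applied to [(f (e^w) - f 0) / e^w] on a
    rectangle of height 2 pi in the plane of [w], which amounts to integrating
    [(f z - f 0) / z^2] over circles. *)

(** * The Euclidean norm on C^k and the operator norm *)

Local Notation nc := (@ComplexField.Normc.normc _).

Section ComplexModulus.
Variable R : realType.
Implicit Types x y : R[i].

Lemma nc_ge0 x : 0 <= nc x.
Proof. by case: x => a b; exact: sqrtr_ge0. Qed.

Lemma nc0 : nc (0 : R[i]) = 0.
Proof. exact: ComplexField.Normc.normc0. Qed.

Lemma nc_real (r : R) : nc (r%:C)%C = `|r|.
Proof. by rewrite /= expr0n addr0 sqrtr_sqr. Qed.

Lemma nc_distC x y : nc (x - y) = nc (y - x).
Proof. by rewrite -normcN opprB. Qed.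

Lemma nc_ge_Re x : `|complex.Re x| <= nc x.
Proof.
by case: x => a b /=; rewrite -sqrtr_sqr ler_wsqrtr // lerDl sqr_ge0.
Qed.

Lemma nc_ge_Im x : `|complex.Im x| <= nc x.
Proof.
by case: x => a b /=; rewrite -sqrtr_sqr ler_wsqrtr // lerDr sqr_ge0.
Qed.

Lemma nc_le_ReIm x : nc x <= `|complex.Re x| + `|complex.Im x|.
Proof.
have h : 0 <= `|complex.Re x| + `|complex.Im x| by rewrite addr_ge0.
rewrite -(@ler_pXn2r _ 2) ?nnegrE ?nc_ge0 //.
case: x h => a b /= h.
rewrite sqr_sqrtr ?addr_ge0 ?sqr_ge0 // sqrrD !real_normK ?num_real //.
by rewrite -addrA [_ *+ 2 + _]addrC addrA lerDl mulrn_wge0 // mulr_ge0.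
Qed.

(** Multiplying by the conjugate derivative turns a bound on a real part into a
    bound on a modulus. *)
Lemma Re_conjM x : complex.Re (x^*%C * x) = nc x ^+ 2.
Proof.
by case: x => a b /=; rewrite sqr_sqrtr ?addr_ge0 ?sqr_ge0 //; ring.
Qed.

Lemma nc_conj x : nc (x^*%C) = nc x.
Proof. by case: x => a b /=; rewrite sqrrN. Qed.

Lemma norm_nc x : `|x| = (nc x)%:C%C.
Proof. by case: x. Qed.

End ComplexModulus.

Section EuclideanNorm.
Variables (R : realType) (k : nat).
Implicit Types (u v : 'rV[R[i]]_k) (M : 'M[R[i]]_k).

Lemma eucl_ge0 v : 0 <= eucl_norm v.
Proof. exact: sqrtr_ge0. Qed.

Lemma sum_sq_nc_ge0 v : 0 <= \sum_(j < k) nc (v 0 j) ^+ 2.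
Proof. by apply: sumr_ge0 => j _; exact: sqr_ge0. Qed.

Lemma eucl_sq v : eucl_norm v ^+ 2 = \sum_(j < k) nc (v 0 j) ^+ 2.
Proof. by rewrite sqr_sqrtr // sum_sq_nc_ge0. Qed.

Lemma nc_coord_le v j : nc (v 0 j) <= eucl_norm v.
Proof.
rewrite -(@ler_pXn2r _ 2) ?nnegrE ?nc_ge0 ?eucl_ge0 // eucl_sq (bigD1 j) //=.
by rewrite lerDl; apply: sumr_ge0 => i _; exact: sqr_ge0.
Qed.

Lemma eucl0 : eucl_norm (0 : 'rV[R[i]]_k) = 0.
Proof.
by rewrite /eucl_norm big1 ?sqrtr0 // => j _; rewrite mxE nc0 expr0n.
Qed.

Lemma eucl0_eq0 v : eucl_norm v = 0 -> v = 0.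
Proof.
move=> v0; apply/rowP => j; rewrite mxE; apply: ComplexField.Normc.eq0_normc.
by apply/eqP; rewrite eq_le nc_ge0 andbT -v0 nc_coord_le.
Qed.

Lemma eucl_gt0 v : v != 0 -> 0 < eucl_norm v.
Proof.
move=> v0; rewrite lt_neqAle eucl_ge0 andbT eq_sym.
by apply: contra_neq v0 => /eucl0_eq0.
Qed.

Lemma euclZ (c : R[i]) v : eucl_norm (c *: v) = nc c * eucl_norm v.
Proof.
rewrite /eucl_norm.
under eq_bigr do rewrite mxE ComplexField.Normc.normcM exprMn.
by rewrite -mulr_sumr sqrtrM ?sqr_ge0 // sqrtr_sqr ger0_norm ?nc_ge0.
Qed.

Lemma euclZr (r : R) v : eucl_norm (r%:C%C *: v) = `|r| * eucl_norm v.
Proof. by rewrite euclZ nc_real. Qed.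

Lemma euclN v : eucl_norm (- v) = eucl_norm v.
Proof.
by rewrite /eucl_norm; congr Num.sqrt; apply: eq_bigr => j _; rewrite mxE normcN.
Qed.

Lemma eucl_distC u v : eucl_norm (u - v) = eucl_norm (v - u).
Proof. by rewrite -euclN opprB. Qed.

(** Minkowski's inequality, from the convexity estimate
    [(x + y)^2 <= (a + b) (x^2 / a + y^2 / b)] applied coordinatewise with [a] and
    [b] the two norms. *)
Lemma euclD u v : eucl_norm (u + v) <= eucl_norm u + eucl_norm v.
Proof.
have [->|/eucl_gt0] := eqVneq u 0; first by rewrite add0r eucl0 add0r.
have [->|/eucl_gt0] := eqVneq v 0; first by rewrite addr0 eucl0 addr0.
have := eucl_sq u; have := eucl_sq v.
set a := eucl_norm u; set b := eucl_norm v => hb ha b0 a0.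
rewrite -(@ler_pXn2r _ 2) ?nnegrE ?eucl_ge0 ?addr_ge0 ?(ltW a0) ?(ltW b0) //.
rewrite eucl_sq.
have -> : (a + b) ^+ 2 = \sum_(j < k)
    (a + b) * (nc (u 0 j) ^+ 2 / a + nc (v 0 j) ^+ 2 / b).
  rewrite -mulr_sumr big_split /= -!mulr_suml -ha -hb.
  by field; rewrite !gt_eqF.
apply: ler_sum => j _; rewrite mxE.
apply: (@le_trans _ _ ((nc (u 0 j) + nc (v 0 j)) ^+ 2)).
  by rewrite ler_pXn2r ?nnegrE ?nc_ge0 ?addr_ge0 ?nc_ge0 // le_normcD.
rewrite -subr_ge0.
set x := nc (u 0 j); set y := nc (v 0 j).
have -> : (a + b) * (x ^+ 2 / a + y ^+ 2 / b) - (x + y) ^+ 2 =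
    (b * x - a * y) ^+ 2 / (a * b) by field; rewrite !gt_eqF.
by rewrite divr_ge0 ?sqr_ge0 // mulr_ge0 // ltW.
Qed.

Lemma euclB u v : eucl_norm (u - v) <= eucl_norm u + eucl_norm v.
Proof. by rewrite -(euclN v) euclD. Qed.

Lemma eucl_triangle w u v :
  eucl_norm (u - v) <= eucl_norm (u - w) + eucl_norm (w - v).
Proof. by rewrite -[u - v](subrKA w) euclD. Qed.

Lemma eucl_le_sum v : eucl_norm v <= \sum_(j < k) nc (v 0 j).
Proof.
rewrite {1}[v]row_sum_delta.
elim/big_rec2: _ => [|j r w _ h]; first by rewrite eucl0.
apply: le_trans (euclD _ _) _; apply: lerD => //.
rewrite euclZ ler_piMr ?nc_ge0 // /eucl_norm.
rewrite -[leRHS]sqrtr1 ler_wsqrtr // (bigD1 j) //= !mxE !eqxx /= big1 ?addr0.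
  by rewrite expr0n /= addr0 sqrtr_sqr normr1 expr1n.
by move=> i ij; rewrite !mxE (negbTE ij) andbF nc0 expr0n.
Qed.

Lemma op_normP v M : eucl_norm (v *m M) <= op_norm M * eucl_norm v.
Proof.
have [->|v0] := eqVneq v 0; first by rewrite mul0mx eucl0 mulr0.
have nv := eucl_gt0 v0.
rewrite -ler_pdivrMr //.
have -> : eucl_norm (v *m M) / eucl_norm v =
    eucl_norm (((eucl_norm v)^-1)%:C%C *: v *m M).
  by rewrite -scalemxAl euclZr ger0_norm ?invr_ge0 ?ltW // mulrC.
apply: ub_le_sup; first exact: (op_norm_has_sup M).2.
eexists; last reflexivity.
by rewrite /= euclZr ger0_norm ?invr_ge0 ?(ltW nv) // mulVf ?gt_eqF.
Qed.

Lemma op_norm_le M L :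
  (forall v, eucl_norm v <= 1 -> eucl_norm (v *m M) <= L) -> op_norm M <= L.
Proof.
move=> h; apply: ge_sup; first exact: (op_norm_has_sup M).1.
by move=> _ [v /= v1 <-]; exact: h.
Qed.

Lemma op_norm_ge0 M : 0 <= op_norm M.
Proof.
apply: ub_le_sup; first exact: (op_norm_has_sup M).2.
by exists 0; rewrite /= ?mul0mx eucl0 // ler01.
Qed.

End EuclideanNorm.

Lemma op_norm1 (R : realType) (k : nat) :
  (0 < k)%N -> 1 <= op_norm (1%:M : 'M[R[i]]_k).
Proof.
move=> k0; pose e := delta_mx 0 (Ordinal k0) : 'rV[R[i]]_k.
have e0 : e != 0.
  apply/eqP => /rowP/(_ (Ordinal k0)); rewrite !mxE !eqxx /=.
  by move=> /eqP; rewrite oner_eq0.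
have := op_normP e 1%:M; rewrite mulmx1.
by rewrite -[leLHS]mul1r ler_pM2r // eucl_gt0.
Qed.

(** * Comparison with the sup-norm topology *)

Section Topology.
Variables (R : realType) (k : nat).
Implicit Types (z v h : 'rV[R[i]]_k) (A : 'M[R[i]]_k).

Lemma gt0_complexE (e : R[i]) : 0 < e -> e = ((complex.Re e)%:C)%C /\ 0 < complex.Re e.
Proof. by rewrite ltcE /= => /andP[/eqP h ->]; case: e h => a b /= ->. Qed.

Lemma ball_rVP z (r : R) v : 0 < r ->
  ball z (r%:C)%C v <-> forall j, nc (v 0 j - z 0 j) < r.
Proof.
move=> r0; split=> [[_ h] j|h].
  by have := h 0 j; rewrite -ball_normE /= norm_nc ltcR nc_distC.
split=> [|i j]; first by rewrite ltcR.
by rewrite (ord1 i) -ball_normE /= norm_nc ltcR nc_distC.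
Qed.

(** The matrix topology comes from the sup norm; the two norms are equivalent, so
    Euclidean balls form a neighbourhood basis. *)
Lemma nbhs_euclP z (S : set 'rV[R[i]]_k) :
  nbhs z S <-> exists2 d : R, 0 < d & eucl_ball z d `<=` S.
Proof.
split=> [/nbhs_ballP[e /= e0 zS]|[d d0 zS]].
  have [eE r0] := gt0_complexE e0; exists (complex.Re e) => // v vz.
  apply: zS; rewrite eE; apply/ball_rVP => // j.
  by apply: le_lt_trans vz; have := nc_coord_le (v - z) j; rewrite !mxE.
have d1 : 0 < d / k.+1%:R by rewrite divr_gt0.
apply/nbhs_ballP; exists ((d / k.+1%:R)%:C)%C; first by rewrite /= ltcR.
move=> v /(ball_rVP _ _ d1) vz; apply: zS; rewrite /eucl_ball /=.
apply: le_lt_trans (eucl_le_sum _) _.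
apply: (@le_lt_trans _ _ (\sum_(j < k) d / k.+1%:R)).
  by apply: ler_sum => j _; rewrite !mxE ltW // vz.
rewrite sumr_const card_ord -[ltLHS]mulr_natr mulrAC ltr_pdivrMr ?ltr0Sn //.
by rewrite ltr_pM2l // ltr_nat.
Qed.

Lemma rV_norm_le v : `|v| <= ((eucl_norm v)%:C)%C.
Proof.
rewrite [leLHS]/Num.Def.normr /=.
have [->|v0] := eqVneq (mx_norm v) 0; first by rewrite lecR eucl_ge0.
have [[i j] ->] := mx_norm_neq0 v0.
by rewrite (ord1 i) norm_nc lecR nc_coord_le.
Qed.

Lemma rV_norm_ge v : ((eucl_norm v)%:C)%C <= k%:R * `|v|.
Proof.
have : 0 <= `|v| by [].
rewrite le0r => /orP[/eqP|/gt0_complexE[nvE _]].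
  by move=> /eqP; rewrite normr_eq0 => /eqP ->; rewrite eucl0 normr0 mulr0.
have vj j : nc (v 0 j) <= complex.Re `|v|.
  rewrite -lecR -nvE -norm_nc [leRHS]/Num.Def.normr /= mx_normE.
  have -> : `|v 0 j| = (`|v 0 j|%:nng)%:num by [].
  rewrite num_le.
  by apply/bigmax_geP; right => /=; exists (0, j).
rewrite nvE -(rmorph_nat (real_complex R)) -rmorphM lecR.
apply: le_trans (eucl_le_sum _) _.
rewrite mulr_natl -[X in _ *+ X]card_ord -sumr_const.
by apply: ler_sum.
Qed.

(** The derivative is an explicit argument because difference quotients and
    Newton maps come with a formula for theirs. *)
Definition frechet (f : 'rV[R[i]]_k -> 'rV[R[i]]_k) z A :=
  forall e : R, 0 < e -> exists2 d : R, 0 < d &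
    forall h, eucl_norm h < d ->
      eucl_norm (f (z + h) - f z - h *m A) <= e * eucl_norm h.

Lemma differentiable_frechet (f : 'rV[R[i]]_k -> 'rV[R[i]]_k) z :
  differentiable f z -> frechet f z ('J f z).
Proof.
move=> df e e0.
have k0 : 0 < e / k.+1%:R by rewrite divr_gt0.
have := diff_locallyxC df.
set o := 'o_ _ _ => fE.
have : \forall h \near (0 : 'rV[R[i]]_k), `|o h| <= ((e / k.+1%:R)%:C)%C * `|h|.
  by apply: (littleoP o); rewrite ltcR.
move=> /nbhs_euclP[d d0 hd]; exists d => // h hdd.
have -> : h *m 'J f z = 'd f z h by rewrite /jacobian mul_rV_lin1.
rewrite fE.
rewrite -[_ - f z - _]addrA -opprD [_ + o h - _]addrC addKr.
rewrite -lecR; apply: le_trans (rV_norm_ge _) _.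
have : eucl_ball 0 d h by rewrite /eucl_ball /= subr0.
move=> /hd /= oh.
apply: le_trans (ler_wpM2l _ oh) _; first by rewrite ler0n.
apply: (@le_trans _ _ (k%:R * (((e / k.+1%:R)%:C)%C * ((eucl_norm h)%:C)%C))).
  by rewrite ler_wpM2l ?ler0n // ler_wpM2l ?rV_norm_le // lecR ltW.
rewrite -(rmorph_nat (real_complex R)) -!rmorphM lecR mulrA.
apply: ler_wpM2r; first exact: eucl_ge0.
rewrite mulrCA ler_piMr ?(ltW e0) // ler_pdivrMr ?ltr0Sn // mul1r ler_nat.
exact: leqnSn.
Qed.

End Topology.

(** * Bisection and integrals on segments *)

Section Bisection.
Variable R : realType.

Lemma nested_halving (a : nat -> R) (w : R) : 0 <= w ->
  (forall n, a n <= a n.+1 <= a n + w / 2 ^+ n.+1) ->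
  exists x, forall n, a n <= x <= a n + w / 2 ^+ n.
Proof.
move=> w0 step.
have len_ge0 n : 0 <= w / 2 ^+ n by rewrite divr_ge0 // exprn_ge0.
have half n : w / 2 ^+ n = w / 2 ^+ n.+1 + w / 2 ^+ n.+1.
  by rewrite exprS; field; rewrite expf_neq0.
have left_incr m n : (m <= n)%N -> a m <= a n.
  move=> /subnKC <-; elim: (n - m)%N => [|j IH]; first by rewrite addn0.
  by rewrite addnS; apply: le_trans IH _; case/andP: (step (m + j)%N).
have right_decr m n : (m <= n)%N -> a n + w / 2 ^+ n <= a m + w / 2 ^+ m.
  move=> /subnKC <-; elim: (n - m)%N => [|j IH]; first by rewrite addn0.
  rewrite addnS; apply: le_trans _ IH; case/andP: (step (m + j)%N) => _ h.
  by rewrite [w / 2 ^+ (m + j)]half; lra.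
have bnd m n : a m <= a n + w / 2 ^+ n.
  have [mn|/ltnW nm] := leqP m n.
    by apply: le_trans (left_incr _ _ mn) _; rewrite lerDl.
  by apply: le_trans _ (right_decr _ _ nm); rewrite lerDl.
have hs : has_sup (range a).
  by split; [exists (a 0%N), 0%N|exists (a 0%N + w / 2 ^+ 0) => _ [n _ <-]].
exists (sup (range a)) => n; apply/andP; split.
  by apply: ub_le_sup; [exact: hs.2|exists n].
by apply: ge_sup; [exact: hs.1|move=> _ [m _ <-]].
Qed.

Lemma divr_exp2_lt (w d : R) : 0 < d -> exists n, w / 2 ^+ n < d.
Proof.
move=> d0; exists (Num.bound (w / d)).
by rewrite ltr_pdivrMr ?exprn_gt0 // -ltr_pdivrMl // mulrC upper_nthrootP.
Qed.

(** Cousin's lemma in the plane: if [P] failed on the initial rectangle, it would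
    fail on one of its quarters, and so on, along rectangles shrinking to a point
    [(x, y)] that they all contain. *)
Lemma rect_bisection (P : R -> R -> R -> R -> Prop) (a0 c0 w0 h0 : R) :
  let inside a c w h := [/\ 0 <= w, 0 <= h,
    a0 <= a /\ a + w <= a0 + w0 & c0 <= c /\ c + h <= c0 + h0] in
  0 <= w0 -> 0 <= h0 ->
  (forall a c w h, inside a c w h ->
    P a c (w / 2) (h / 2) -> P (a + w / 2) c (w / 2) (h / 2) ->
    P a (c + h / 2) (w / 2) (h / 2) ->
    P (a + w / 2) (c + h / 2) (w / 2) (h / 2) -> P a c w h) ->
  (forall x y, a0 <= x <= a0 + w0 -> c0 <= y <= c0 + h0 ->
    exists2 d, 0 < d & forall a c w h, inside a c w h ->
      a <= x <= a + w -> c <= y <= c + h -> w < d -> h < d -> P a c w h) ->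
  P a0 c0 w0 h0.
Proof.
move=> inside w00 h00 quarters loc; apply: contrapT => nP.
pose W n := w0 / 2 ^+ n; pose H n := h0 / 2 ^+ n.
have W0 n : 0 <= W n by rewrite divr_ge0 // exprn_ge0.
have H0 n : 0 <= H n by rewrite divr_ge0 // exprn_ge0.
have WS n : W n.+1 = W n / 2 by rewrite /W exprSr invfM mulrA.
have HS n : H n.+1 = H n / 2 by rewrite /H exprSr invfM mulrA.
pose bad (p : R * R * nat) := inside p.1.1 p.1.2 (W p.2) (H p.2) /\
  ~ P p.1.1 p.1.2 (W p.2) (H p.2).
pose next (p q : R * R * nat) := bad p ->
  [/\ bad q, q.2 = p.2.+1, p.1.1 <= q.1.1 <= p.1.1 + W p.2.+1 &
      p.1.2 <= q.1.2 <= p.1.2 + H p.2.+1].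
have ex_next p : {q | next p q}.
  apply: cid; have [bp|nbp] := pselect (bad p); last by exists p.
  case: p bp => -[a c] n [/= ins nPp].
  have [wn hn [a1 a2] [c1 c2]] := ins.
  have := W0 n.+1; have := H0 n.+1; have := WS n; have := HS n => hH hW ge0H ge0W.
  apply: contrapT => noq; apply: nPp; apply: quarters => //; rewrite -hH -hW.
  - apply: contrapT => nPq; apply: (noq).
    by exists (a, c, n.+1) => _; split=> //=; [split=> //=; split=> //; split; lra|..];
      apply/andP; split; lra.
  - apply: contrapT => nPq; apply: (noq).
    by exists (a + W n.+1, c, n.+1) => _; split=> //=; [split=> //=; split=> //; split; lra|..];
      apply/andP; split; lra.
  - apply: contrapT => nPq; apply: (noq).
    by exists (a, c + H n.+1, n.+1) => _; split=> //=; [split=> //=; split=> //; split; lra|..];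
      apply/andP; split; lra.
  - apply: contrapT => nPq; apply: (noq).
    by exists (a + W n.+1, c + H n.+1, n.+1) => _; split=> //=;
      [split=> //=; split=> //; split; lra|..]; apply/andP; split; lra.
have [s [s0 sS]] := dependent_choice ex_next (a0, c0, 0%N).
have badS n : bad (s n) /\ (s n).2 = n.
  elim: n => [|n [bn nE]].
    by rewrite s0; split=> //; split; rewrite /= /W /H expr0 !divr1.
  by have [bn1 n1E _ _] := sS n bn; rewrite n1E nE.
have stepS n : (s n).1.1 <= (s n.+1).1.1 <= (s n).1.1 + W n.+1 /\
               (s n).1.2 <= (s n.+1).1.2 <= (s n).1.2 + H n.+1.
  by have [bn nE] := badS n; have [_ _] := sS n bn; rewrite nE.
have [x xP] := nested_halving w00 (fun n => (stepS n).1).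
have [y yP] := nested_halving h00 (fun n => (stepS n).2).
have s0x : a0 <= x <= a0 + w0 by have := xP 0%N; rewrite s0 /= expr0 divr1.
have s0y : c0 <= y <= c0 + h0 by have := yP 0%N; rewrite s0 /= expr0 divr1.
have [d d0 small] := loc x y s0x s0y.
have [n nd] := divr_exp2_lt (w0 + h0) d0.
have [[insn nPn] nE] := badS n; apply: nPn; rewrite nE in insn *.
have := W0 n; have := H0 n; rewrite mulrDl -/(W n) -/(H n) in nd => Hn Wn.
by apply: small => //; lra.
Qed.

End Bisection.

Section IntegralSegment.
Variable R : realType.
Implicit Types (f g : R -> R) (a b m : R).
Notation mu := (@lebesgue_measure R).

Definition seg_integral f a b : R := \int[mu]_(x in `[a, b]) f x.

Definition seg_integrable f a b := mu.-integrable `[a, b] (EFin \o f).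

Lemma seg_integrableS f a b a' b' : a <= a' -> b' <= b ->
  seg_integrable f a b -> seg_integrable f a' b'.
Proof.
move=> aa bb; apply: integrableS => //.
by move=> x /=; rewrite !in_itv /= => /andP[h1 h2]; apply/andP; split; lra.
Qed.

Lemma seg_integrableB f g a b :
  seg_integrable f a b -> seg_integrable g a b ->
  seg_integrable (fun x => f x - g x) a b.
Proof.
move=> fi gi; have h : mu.-integrable `[a, b] (fun x => ((f x)%:E - (g x)%:E)%E).
  exact: integrableB.
exact: eq_integrable h.
Qed.

Lemma seg_integrable_cst (r : R) a b : seg_integrable (fun=> r) a b.
Proof.
apply: continuous_compact_integrable; first exact: segment_compact.
by move=> x; exact: cst_continuous.
Qed.

Lemma continuous_seg_integrable f a b :
  (forall x, a <= x <= b -> forall e, 0 < e -> exists2 d, 0 < d &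
     forall y, a <= y <= b -> `|y - x| < d -> `|f y - f x| <= e) ->
  seg_integrable f a b.
Proof.
move=> fc; apply: continuous_compact_integrable; first exact: segment_compact.
apply/subspace_continuousP => x /=; rewrite in_itv /= => xab.
apply/cvgrPdist_le => e e0; have [d d0 fd] := fc x xab e e0.
rewrite near_withinE; apply/nbhs_ballP; exists d => //= y.
rewrite -ball_normE /= in_itv /= => xyd yab.
by rewrite distrC; apply: fd => //; rewrite distrC.
Qed.

Lemma seg_integralD f a m b : a <= m -> m <= b -> seg_integrable f a b ->
  seg_integral f a b = seg_integral f a m + seg_integral f m b.
Proof.
move=> am mb fi.
have h : \int[mu]_(x in `[a, b]) f x - \int[mu]_(x in `[a, m]) f x
   = \int[mu]_(x in `]m, b]) f x by apply: Rintegral_itvB.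
apply/eqP; rewrite addrC -subr_eq; apply/eqP; rewrite [LHS]h.
apply: Rintegral_itv_obnd_cbnd.
apply: integrableS fi => //.
by move=> x /=; rewrite !in_itv /= => /andP[h1 h2]; apply/andP; split; lra.
Qed.

Lemma seg_integralB f g a b : seg_integrable f a b -> seg_integrable g a b ->
  seg_integral (fun x => f x - g x) a b = seg_integral f a b - seg_integral g a b.
Proof. by move=> fi gi; exact: RintegralB. Qed.

Lemma seg_integral_cst (r : R) a b : a <= b ->
  seg_integral (fun=> r) a b = r * (b - a).
Proof.
move=> ab; rewrite /seg_integral Rintegral_cst //.
have := @lebesgue_measure_itv R `[a, b]; rewrite /= lte_fin => ->.
case: ltP => // ba; have -> : a = b by lra.
by rewrite subrr.
Qed.

Lemma ler_seg_integral f g a b : seg_integrable f a b -> seg_integrable g a b ->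
  (forall x, a <= x <= b -> f x <= g x) -> seg_integral f a b <= seg_integral g a b.
Proof.
by move=> fi gi fg; exact: le_Rintegral.
Qed.

Lemma seg_integral_dist f (r K : R) a b : a <= b -> seg_integrable f a b ->
  (forall x, a <= x <= b -> `|f x - r| <= K) ->
  `|seg_integral f a b - r * (b - a)| <= K * (b - a).
Proof.
move=> ab fi fK.
have up : seg_integral f a b <= (r + K) * (b - a).
  rewrite -seg_integral_cst //; apply: ler_seg_integral => //.
    exact: seg_integrable_cst.
  by move=> x /fK; rewrite ler_norml => /andP[_]; lra.
have dn : (r - K) * (b - a) <= seg_integral f a b.
  rewrite -seg_integral_cst //; apply: ler_seg_integral => //.
    exact: seg_integrable_cst.
  by move=> x /fK; rewrite ler_norml => /andP[+ _]; lra.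
by rewrite ler_norml; apply/andP; split; lra.
Qed.

End IntegralSegment.

(** * Goursat's theorem for closed forms *)

Section Goursat.
Variable R : realType.
Implicit Types (P Q F : R -> R -> R) (a c w h x y : R).

Definition diff2 F x y (Fx Fy : R) :=
  forall e, 0 < e -> exists2 d, 0 < d & forall s t, `|s| < d -> `|t| < d ->
    `|F (x + s) (y + t) - F x y - Fx * s - Fy * t| <= e * (`|s| + `|t|).

(** The integral of [P dx + Q dy] along the boundary of a rectangle,
    counterclockwise.  Opposite sides are paired because the increment of an
    affine function across the rectangle is constant. *)
Definition circulation P Q a c w h : R :=
  seg_integral (fun x => P x c - P x (c + h)) a (a + w) +
  seg_integral (fun y => Q (a + w) y - Q a y) c (c + h).

Lemma diff2_slice1 F x y Fx Fy : diff2 F x y Fx Fy ->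
  forall e, 0 < e -> exists2 d, 0 < d &
    forall u, `|u - x| < d -> `|F u y - F x y| <= e.
Proof.
move=> dF e e0; have [d d0 h] := dF 1 ltr01.
have K0 : 0 < `|Fx| + 1 by rewrite ltr_wpDl.
exists (Num.min d (e / (`|Fx| + 1))) => [|u].
  by rewrite lt_min d0 divr_gt0.
rewrite lt_min => /andP[ud ue].
have := h (u - x) 0 ud; rewrite normr0 => /(_ d0).
rewrite addr0 mulr0 subr0 addr0 mul1r [x + _]addrC subrK => hu.
have : `|F u y - F x y| <= (`|Fx| + 1) * `|u - x|.
  rewrite -[F u y - F x y](subrK (Fx * (u - x))).
  apply: le_trans (ler_normD _ _) _; rewrite normrM mulrDl mul1r addrC.
  exact: lerD.
move/le_trans; apply; rewrite mulrC -ler_pdivlMr //; exact: ltW.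
Qed.

Lemma diff2_swap F x y Fx Fy : diff2 F x y Fx Fy ->
  diff2 (fun u v => F v u) y x Fy Fx.
Proof.
move=> dF e e0; have [d d0 h] := dF e e0; exists d => // s t sd td.
by rewrite addrAC [_ - Fy * s]addrAC [`|s| + _]addrC addrAC h.
Qed.

Lemma diff2_slice2 F x y Fx Fy : diff2 F x y Fx Fy ->
  forall e, 0 < e -> exists2 d, 0 < d &
    forall v, `|v - y| < d -> `|F x v - F x y| <= e.
Proof. by move=> /diff2_swap /diff2_slice1. Qed.

Definition slices_integrable P Q a c w h :=
  (forall y, c <= y <= c + h -> seg_integrable (P^~ y) a (a + w)) /\
  (forall x, a <= x <= a + w -> seg_integrable (Q x) c (c + h)).

Lemma circulation_quarters P Q a c w h : 0 <= w -> 0 <= h ->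
  slices_integrable P Q a c w h ->
  circulation P Q a c w h =
    circulation P Q a c (w / 2) (h / 2) +
    circulation P Q (a + w / 2) c (w / 2) (h / 2) +
    circulation P Q a (c + h / 2) (w / 2) (h / 2) +
    circulation P Q (a + w / 2) (c + h / 2) (w / 2) (h / 2).
Proof.
move=> w0 h0 [Pint Qint].
have half (r s : R) : r + s / 2 + s / 2 = r + s by lra.
rewrite /circulation !half; set m := a + w / 2; set n := c + h / 2.
have am : a <= m by rewrite lerDl divr_ge0.
have mw : m <= a + w by rewrite lerD2l ler_pdivrMr // ler_peMr // ler1n.
have cn : c <= n by rewrite lerDl divr_ge0.
have nh : n <= c + h by rewrite lerD2l ler_pdivrMr // ler_peMr // ler1n.
have aw := le_trans am mw; have ch := le_trans cn nh.
have Psub y : c <= y <= c + h -> [/\ seg_integrable (P^~ y) a (a + w),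
    seg_integrable (P^~ y) a m & seg_integrable (P^~ y) m (a + w)].
  by move=> /Pint Py; split=> //; apply: seg_integrableS Py.
have Qsub x : a <= x <= a + w -> [/\ seg_integrable (Q x) c (c + h),
    seg_integrable (Q x) c n & seg_integrable (Q x) n (c + h)].
  by move=> /Qint Qx; split=> //; apply: seg_integrableS Qx.
have [|? ? ?] := Psub c; first by rewrite lexx.
have [|? ? ?] := Psub n; first by rewrite cn.
have [|? ? ?] := Psub (c + h); first by rewrite lexx andbT.
have [|? ? ?] := Qsub a; first by rewrite lexx.
have [|? ? ?] := Qsub m; first by rewrite am.
have [|? ? ?] := Qsub (a + w); first by rewrite lexx andbT.
rewrite !seg_integralB // !(@seg_integralD _ (P^~ _) a m (a + w)) //.
rewrite !(@seg_integralD _ (Q _) c n (c + h)) //.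
by ring.
Qed.

(** The affine parts of [P] and [Q] contribute [- m h w] and [m w h], which cancel
    because [P_y] and [Q_x] are the same number [m]. *)
Lemma circulation_affine P Q a c w h (p q px m qy x y e : R) :
  0 <= w -> 0 <= h -> slices_integrable P Q a c w h ->
  (forall u v, a <= u <= a + w -> c <= v <= c + h ->
     `|P u v - p - px * (u - x) - m * (v - y)| <= e /\
     `|Q u v - q - m * (u - x) - qy * (v - y)| <= e) ->
  `|circulation P Q a c w h| <= 2 * e * (w + h).
Proof.
move=> w0 h0 [Pint Qint] aff.
have aw : a <= a + w by rewrite lerDl.
have ch : c <= c + h by rewrite lerDl.
have ina : a <= a <= a + w by rewrite lexx.
have inw : a <= a + w <= a + w by rewrite lexx andbT.
have inc : c <= c <= c + h by rewrite lexx.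
have inh : c <= c + h <= c + h by rewrite lexx andbT.
have diff2e (r s A B : R) : A - B = r - s -> `|r| <= e -> `|s| <= e ->
    `|A - B| <= 2 * e.
  move=> -> re se; apply: le_trans (ler_normB _ _) _.
  by rewrite mulr_natl mulr2n lerD.
have JP : `|seg_integral (fun u => P u c - P u (c + h)) a (a + w)
           - (- (m * h)) * (a + w - a)| <= 2 * e * (a + w - a).
  apply: seg_integral_dist => // [|u ua].
    by apply: seg_integrableB; exact: Pint.
  have [A _] := aff u c ua inc; have [B _] := aff u (c + h) ua inh.
  by apply: diff2e A B; ring.
have JQ : `|seg_integral (fun v => Q (a + w) v - Q a v) c (c + h)
           - m * w * (c + h - c)| <= 2 * e * (c + h - c).
  apply: seg_integral_dist => // [|v vc].
    by apply: seg_integrableB; exact: Qint.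
  have [_ A] := aff (a + w) v inw vc; have [_ B] := aff a v ina vc.
  by apply: diff2e A B; ring.
rewrite /circulation; move: JP JQ.
set I1 := seg_integral _ _ _; set I2 := seg_integral _ _ _.
have -> : a + w - a = w by ring.
have -> : c + h - c = h by ring.
have -> : I1 + I2 = (I1 - (- (m * h)) * w) + (I2 - m * w * h) by ring.
move=> J1 J2; apply: le_trans (ler_normD _ _) _.
by rewrite mulrDr lerD.
Qed.

Lemma closed_slices_integrable P Q a0 c0 w0 h0 a c w h :
  (forall x y, a0 <= x <= a0 + w0 -> c0 <= y <= c0 + h0 ->
     exists px m qy, diff2 P x y px m /\ diff2 Q x y m qy) ->
  a0 <= a -> a + w <= a0 + w0 -> c0 <= c -> c + h <= c0 + h0 ->
  slices_integrable P Q a c w h.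
Proof.
move=> closed a1 a2 c1 c2; split=> [y /andP[y1 y2]|x /andP[x1 x2]].
  have yc : c0 <= y <= c0 + h0 by rewrite (le_trans c1) ?(le_trans y2).
  apply: seg_integrableS a1 a2 _.
  apply: continuous_seg_integrable => x xa e e0.
  have [px [m [qy [dP _]]]] := closed x y xa yc.
  have [d d0 hd] := diff2_slice1 dP e0.
  by exists d => // u _; exact: hd.
have xa : a0 <= x <= a0 + w0 by rewrite (le_trans a1) ?(le_trans x2).
apply: seg_integrableS c1 c2 _.
apply: continuous_seg_integrable => y yc e e0.
have [px [m [qy [_ dQ]]]] := closed x y xa yc.
have [d d0 hd] := diff2_slice2 dQ e0.
by exists d => // u _; exact: hd.
Qed.

(** Goursat's theorem for closed forms with merely differentiable coefficients:
    the circulation is additive under subdivision, and on a small rectangle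
    around a point it is a negligible multiple of the squared size. *)
Lemma goursat P Q a0 c0 w0 h0 : 0 <= w0 -> 0 <= h0 ->
  (forall x y, a0 <= x <= a0 + w0 -> c0 <= y <= c0 + h0 ->
     exists px m qy, diff2 P x y px m /\ diff2 Q x y m qy) ->
  circulation P Q a0 c0 w0 h0 = 0.
Proof.
move=> w00 h00 closed.
have slices a c w h := @closed_slices_integrable P Q a0 c0 w0 h0 a c w h closed.
suff small e : 0 < e -> `|circulation P Q a0 c0 w0 h0| <= e * (w0 + h0) ^+ 2.
  apply/eqP; rewrite -normr_le0; apply/ler_addgt0Pl => r r0; rewrite addr0.
  have K0 : 0 < (w0 + h0) ^+ 2 + 1 by rewrite ltr_wpDl // sqr_ge0.
  apply: le_trans (small _ (divr_gt0 r0 K0)) _.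
  by rewrite mulrAC ler_pdivrMr // ler_pM2l // lerDl ler01.
move=> e0; apply: (@rect_bisection _ (fun a c w h =>
  `|circulation P Q a c w h| <= e * (w + h) ^+ 2)) => //.
  move=> a c w h [w_ge0 h_ge0 [a1 a2] [c1 c2]] q1 q2 q3 q4.
  rewrite circulation_quarters //; last exact: slices.
  have -> : e * (w + h) ^+ 2 =
      e * (w / 2 + h / 2) ^+ 2 + e * (w / 2 + h / 2) ^+ 2 +
      e * (w / 2 + h / 2) ^+ 2 + e * (w / 2 + h / 2) ^+ 2 by field.
  by do 3 (apply: le_trans (ler_normD _ _) _; apply: lerD => //).
move=> x y xa yc; have [px [m [qy [dP dQ]]]] := closed x y xa yc.
have e2 : 0 < e / 2 by rewrite divr_gt0.
have [d1 d10 hP] := dP _ e2; have [d2 d20 hQ] := dQ _ e2.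
exists (Num.min d1 d2) => [|a c w h]; first by rewrite lt_min d10.
move=> [w_ge0 h_ge0 [a1 a2] [c1 c2]] /andP[ax xw] /andP[cy yh].
rewrite !lt_min => /andP[w1 w2] /andP[h1 h2].
have -> : e * (w + h) ^+ 2 = 2 * (e / 2 * (w + h)) * (w + h) by field.
apply: (@circulation_affine _ _ _ _ _ _ (P x y) (Q x y) px m qy x y) => //.
  exact: slices.
move=> u v /andP[u1 u2] /andP[v1 v2].
have su : `|u - x| <= w.
  by rewrite ler_distl lerBlDr (le_trans xw) ?lerD2r //= (le_trans u2) // lerD2r.
have sv : `|v - y| <= h.
  by rewrite ler_distl lerBlDr (le_trans yh) ?lerD2r //= (le_trans v2) // lerD2r.
have e_le : e / 2 * (`|u - x| + `|v - y|) <= e / 2 * (w + h).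
  by rewrite ler_pM2l // lerD.
split; apply: le_trans e_le.
  have := hP _ _ (le_lt_trans su w1) (le_lt_trans sv h1).
  by rewrite ![_ + (_ - _)]addrC !subrK.
have := hQ _ _ (le_lt_trans su w2) (le_lt_trans sv h2).
by rewrite ![_ + (_ - _)]addrC !subrK.
Qed.

End Goursat.

(** * Cauchy's estimate in one variable *)

Section ComplexDerivative.
Variable R : realType.
Implicit Types (f g : R[i] -> R[i]) (z w h d : R[i]).

Definition cdiff f z d := forall e : R, 0 < e -> exists2 r : R, 0 < r &
  forall h, nc h < r -> nc (f (z + h) - f z - d * h) <= e * nc h.

Lemma cdiff_lip f z d : cdiff f z d ->
  exists2 r : R, 0 < r &
    forall h, nc h < r -> nc (f (z + h) - f z) <= (nc d + 1) * nc h.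
Proof.
move=> fd; have [r r0 hr] := fd 1 ltr01; exists r => // h /hr fh.
rewrite -[f (z + h) - f z](subrK (d * h)).
apply: le_trans (le_normcD _ _) _.
by rewrite ComplexField.Normc.normcM mulrDl addrC lerD.
Qed.

Lemma cdiff_comp f g z df dg : cdiff g z dg -> cdiff f (g z) df ->
  cdiff (f \o g) z (df * dg).
Proof.
move=> hg hf e e0.
have [rl rl0 lip] := cdiff_lip hg.
have L0 : 0 < nc dg + 1 by rewrite ltr_wpDl ?nc_ge0.
have D0 : 0 < nc df + 1 by rewrite ltr_wpDl ?nc_ge0.
have e1 : 0 < e / 2 / (nc dg + 1) by rewrite !divr_gt0.
have e2 : 0 < e / 2 / (nc df + 1) by rewrite !divr_gt0.
have [r1 r10 h1] := hf _ e1; have [r2 r20 h2] := hg _ e2.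
exists (Num.min rl (Num.min r2 (r1 / (nc dg + 1)))) => [|h].
  by rewrite !lt_min rl0 r20 divr_gt0.
rewrite !lt_min => /and3P[hl hh2 hh1].
have lh := lip h hl; set k := g (z + h) - g z in lh.
have kr : nc k < r1.
  by apply: le_lt_trans lh _; rewrite mulrC -ltr_pdivlMr.
have := h1 k kr; have := h2 h hh2; rewrite -/k => A B.
have -> : (f \o g) (z + h) - (f \o g) z - df * dg * h =
    (f (g z + k) - f (g z) - df * k) + df * (k - dg * h).
  by rewrite /= [g z + k]addrC subrK; ring.
apply: le_trans (le_normcD _ _) _; rewrite ComplexField.Normc.normcM.
rewrite [e]splitr mulrDl; apply: lerD.
  apply: le_trans B _; rewrite -mulrA ler_pM2l ?divr_gt0 // mulrC.
  by rewrite ler_pdivrMr // mulrC.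
apply: (@le_trans _ _ ((nc df + 1) * (e / 2 / (nc df + 1) * nc h))).
  by apply: ler_pM; rewrite ?nc_ge0 // lerDl.
by rewrite mulrA [(nc df + 1) * _]mulrC divfK ?gt_eqF.
Qed.

Lemma cdiffM f g z a b : cdiff f z a -> cdiff g z b ->
  cdiff (fun w => f w * g w) z (a * g z + f z * b).
Proof.
move=> hf hg e e0.
have [r r0 lip] := cdiff_lip hg.
pose K := nc (g z) + (nc b + 1) + nc a * (nc b + 1) + nc (f z) + 1.
have L0 : 0 <= nc b + 1 by rewrite addr_ge0 ?nc_ge0.
have K0 : 0 < K.
  by rewrite ltr_wpDl // !addr_ge0 ?mulr_ge0 ?addr_ge0 ?nc_ge0.
have e1 : 0 < e / K by rewrite divr_gt0.
have [r1 r10 h1] := hf _ e1; have [r2 r20 h2] := hg _ e1.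
exists (Num.min r (Num.min r1 (Num.min r2 (Num.min 1 (e / K))))) => [|h].
  by rewrite !lt_min r0 r10 r20 e1 ltr01.
rewrite !lt_min => /and5P[hr hh1 hh2 /ltW hle1 /ltW hleK].
have := h1 h hh1; have := h2 h hh2; have := lip h hr.
set f1 := f (z + h); set g1 := g (z + h) => lipg Hg Hf.
have g1le : nc g1 <= nc (g z) + (nc b + 1).
  rewrite -[g1](subrK (g z)) [leRHS]addrC.
  apply: le_trans (le_normcD _ _) _; rewrite lerD2r.
  by apply: le_trans lipg _; rewrite ler_piMr.
have -> : f1 * g1 - f z * g z - (a * g z + f z * b) * h =
    (f1 - f z - a * h) * g1 + a * h * (g1 - g z) + f z * (g1 - g z - b * h).
  by ring.
apply: (@le_trans _ _ (e / K * nc h * (nc (g z) + (nc b + 1)) +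
    nc a * nc h * ((nc b + 1) * (e / K)) + nc (f z) * (e / K * nc h))).
  apply: le_trans (le_normcD _ _) _; apply: lerD.
    apply: le_trans (le_normcD _ _) _; rewrite !ComplexField.Normc.normcM.
    apply: lerD; apply: ler_pM; rewrite ?mulr_ge0 ?nc_ge0 //.
    by apply: le_trans lipg _; rewrite ler_wpM2l.
  by rewrite ComplexField.Normc.normcM ler_wpM2l ?nc_ge0.
have -> : e / K * nc h * (nc (g z) + (nc b + 1)) +
    nc a * nc h * ((nc b + 1) * (e / K)) + nc (f z) * (e / K * nc h) =
    e / K * nc h * (K - 1) by rewrite /K; ring.
apply: (@le_trans _ _ (e / K * nc h * K)).
  apply: ler_wpM2l; first by rewrite mulr_ge0 ?nc_ge0 // ltW.
  by rewrite gerBl ler01.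
by rewrite mulrAC divfK ?gt_eqF.
Qed.

Lemma cdiffZ c f z d : cdiff f z d -> cdiff (fun w => c * f w) z (c * d).
Proof.
move=> hf e e0; have c0 : 0 < nc c + 1 by rewrite ltr_wpDl ?nc_ge0.
have [r r0 hr] := hf _ (divr_gt0 e0 c0); exists r => // h /hr fh.
rewrite -mulrA -!mulrBr ComplexField.Normc.normcM.
apply: (@le_trans _ _ ((nc c + 1) * (e / (nc c + 1) * nc h))).
  by apply: ler_pM; rewrite ?nc_ge0 // lerDl.
by rewrite mulrA [(nc c + 1) * _]mulrC divfK ?gt_eqF.
Qed.

Lemma cdiff_subr c f z d : cdiff f z d -> cdiff (fun w => f w - c) z d.
Proof.
move=> hf e /hf[r r0 hr]; exists r => // h /hr.
by have -> : f (z + h) - c - (f z - c) = f (z + h) - f z by ring.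
Qed.

Lemma cdiff_opp z : cdiff -%R z (-1).
Proof.
move=> e e0; exists 1 => // h _.
have -> : - (z + h) - (- z) - (- 1 * h) = 0 by ring.
by rewrite nc0 mulr_ge0 ?nc_ge0 // ltW.
Qed.

(** The Cauchy-Riemann equations: real and imaginary part of a complex
    differentiable function are the coefficients of a closed form. *)
Lemma cdiff_diff2 f (x y : R) d : cdiff f (x +i* y)%C d ->
  diff2 (fun x y => complex.Im (f (x +i* y)%C)) x y (complex.Im d) (complex.Re d) /\
  diff2 (fun x y => complex.Re (f (x +i* y)%C)) x y (complex.Re d) (- complex.Im d).
Proof.
move=> fd.
have main e : 0 < e -> exists2 r, 0 < r & forall s t : R, `|s| < r -> `|t| < r ->
    nc (f ((x + s) +i* (y + t))%C - f (x +i* y)%C - d * (s +i* t)%C) <=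
    e * (`|s| + `|t|).
  move=> e0; have [r r0 hr] := fd e e0.
  exists (r / 2) => [|s t sr tr]; first by rewrite divr_gt0.
  have st : nc (s +i* t)%C <= `|s| + `|t| by exact: nc_le_ReIm.
  have str : `|s| + `|t| < r by rewrite [r]splitr ltrD.
  apply: le_trans (hr (s +i* t)%C (le_lt_trans st str)) _.
  by rewrite ler_pM2l.
split=> e /main[r r0 hr]; exists r => // s t sr tr; apply: le_trans (hr s t sr tr).
  apply: le_trans (nc_ge_Im _).
  case: (f (x +i* y)%C) => u1 v1; case: (f _) => u2 v2; case: d {fd main hr} => p q /=.
  by rewrite le_eqVlt; apply/orP; left; apply/eqP; congr (`|_|); ring.
apply: le_trans (nc_ge_Re _).
case: (f (x +i* y)%C) => u1 v1; case: (f _) => u2 v2; case: d {fd main hr} => p q /=.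
by rewrite le_eqVlt; apply/orP; left; apply/eqP; congr (`|_|); ring.
Qed.

End ComplexDerivative.

Section ComplexExponential.
Variable R : realType.
Implicit Types (z w h : R[i]).

Definition cexp w : R[i] :=
  (expR (complex.Re w) * cos (complex.Im w) +i*
   (expR (complex.Re w) * sin (complex.Im w)))%C.

Lemma cexpD z w : cexp (z + w) = cexp z * cexp w.
Proof.
case: z => a b; case: w => c d; rewrite /cexp /= expRD cosD sinD.
by apply/eqP; rewrite eq_complex /=; apply/andP; split; apply/eqP; ring.
Qed.

Lemma cexp0 : cexp 0 = 1.
Proof.
by rewrite /cexp /= expR0 cos0 sin0 mulr1 mulr0.
Qed.

Lemma nc_cexp w : nc (cexp w) = expR (complex.Re w).
Proof.
rewrite /cexp /= !exprMn -mulrDr cos2Dsin2 mulr1 sqrtr_sqr.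
by rewrite ger0_norm // expR_ge0.
Qed.

Lemma cexp_2pi (x : R) : cexp (x +i* (pi *+ 2))%C = cexp (x +i* 0)%C.
Proof. by rewrite /cexp /= cos2pi sin2pi cos0 sin0. Qed.

Lemma is_derive_at0 (f : R -> R) (d : R) : is_derive (0 : R) (1 : R) f d ->
  forall e, 0 < e -> exists2 r, 0 < r &
    forall t, `|t| < r -> `|f t - f 0 - d * t| <= e * `|t|.
Proof.
move=> fd e e0.
have /derivable1_diffP df : derivable f (0 : R) (1 : R) by exact: ex_derive.
have := diff_locallyxC df; set o := 'o_ _ _ => fE.
have : \forall h \near (0 : R), `|o h| <= e * `|h| by exact: (littleoP o).
move=> /nbhs_ballP[r /= r0 hr]; exists r => // t tr.
have := fE t; rewrite add0r => ->.
have -> : 'd f 0 t = d * t.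
  rewrite -[t in LHS]mulr1 -[t * 1]/(t *: 1) linearZ /= -deriveE //.
  by rewrite derive_val mulrC.
have -> : f 0 + d * t + o t - f 0 - d * t = o t by ring.
by apply: hr; rewrite -ball_normE /= sub0r normrN.
Qed.

Lemma cdiff_cexp w : cdiff cexp w (cexp w).
Proof.
suff at0 : cdiff cexp 0 1.
  move=> e e0; have w0 : 0 < nc (cexp w) by rewrite nc_cexp expR_gt0.
  have [r r0 hr] := at0 _ (divr_gt0 e0 w0); exists r => // h /hr.
  rewrite add0r cexp0 mul1r => hh.
  rewrite cexpD -[X in nc (_ - X - _)]mulr1 -!mulrBr ComplexField.Normc.normcM.
  by rewrite mulrC -ler_pdivlMr // mulrAC.
(* Each of the real and imaginary parts is a sum of products of a bounded factor
   and one of the errors below; altogether they contain seven times [e / 8]. *)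
move=> e e0; have e8 : 0 < e / 8 by rewrite divr_gt0.
have [r1 r10 h1] := is_derive_at0 (is_derive_expR 0) e8.
have [r2 r20 h2] := is_derive_at0 (is_derive_cos 0) e8.
have [r3 r30 h3] := is_derive_at0 (is_derive_sin 0) e8.
exists (Num.min r1 (Num.min r2 (Num.min r3 (Num.min 1 (e / 8))))) => [|h].
  by rewrite !lt_min r10 r20 r30 e8 ltr01.
rewrite !lt_min => /and5P[hr1 hr2 hr3 hr4 hr5].
rewrite add0r cexp0 mul1r; move: hr1 hr2 hr3 hr4 hr5.
have := nc_ge_Re h; have := nc_ge_Im h.
case: h => a b; rewrite [complex.Re _]/= [complex.Im _]/=.
set N := nc _ => bN aN N1 N2 N3 N4 N5.
have := h1 a (le_lt_trans aN N1); rewrite expR0 mul1r => A.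
have := h2 b (le_lt_trans bN N2); rewrite cos0 sin0 oppr0 mul0r subr0 => B.
have := h3 b (le_lt_trans bN N3); rewrite cos0 sin0 subr0 mul1r => D.
have Nle : `|1 + a| <= 2.
  apply: le_trans (ler_normD _ _) _; rewrite normr1 (_ : 2 = 1 + 1) //.
  by rewrite lerD2l (le_trans aN) // ltW.
have c1 : `|cos b| <= 1 by rewrite ler_norml cos_geN1 cos_le1.
have s1 : `|sin b| <= 1 by rewrite ler_norml sin_geN1 sin_le1.
have mul (u v p q : R) : `|u| <= p -> `|v| <= q -> `|u * v| <= p * q.
  by move=> up vq; rewrite normrM ler_pM.
have scale (u v : R) : `|u| <= e / 8 * `|v| -> `|v| <= N -> `|u| <= e / 8 * N.
  by move=> h vN; apply: le_trans h _; rewrite ler_pM2l.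
have {}A := scale _ _ A aN; have {}B := scale _ _ B bN; have {}D := scale _ _ D bN.
have ReE : `|expR a * cos b - 1 - a| <= e / 8 * N * 1 + 2 * (e / 8 * N).
  have -> : expR a * cos b - 1 - a =
    (expR a - 1 - a) * cos b + (1 + a) * (cos b - 1) by ring.
  by apply: le_trans (ler_normD _ _) _; apply: lerD; exact: mul.
have ImE : `|expR a * sin b - b| <= e / 8 * N * 1 + 2 * (e / 8 * N) + N * (e / 8).
  have -> : expR a * sin b - b =
    (expR a - 1 - a) * sin b + (1 + a) * (sin b - b) + b * a by ring.
  apply: le_trans (ler_normD _ _) _; apply: lerD.
    by apply: le_trans (ler_normD _ _) _; apply: lerD; exact: mul.
  by apply: mul => //; exact: le_trans aN (ltW N5).
rewrite /cexp; apply: le_trans (nc_le_ReIm _) _.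
rewrite /= oppr0 addr0; apply: le_trans (lerD ReE ImE) _.
have eN : 0 <= e * N by rewrite mulr_ge0 ?nc_ge0 // ltW.
by clear -eN; lra.
Qed.

End ComplexExponential.

Section CauchyEstimate.
Variable R : realType.
Implicit Types (f : R[i] -> R[i]) (z w : R[i]).

Lemma nc_circle (x y : R) : nc (cexp (x +i* y)%C) = expR x.
Proof. exact: nc_cexp. Qed.

(** In logarithmic coordinates [z = e^w], the function
    [G w = (f (e^w) - f 0) / e^w] is periodic of period 2 pi i, so Goursat's theorem
    makes the mean of [Re G] over a period independent of [Re w].  It tends to
    [Re (f' 0)] when [Re w] tends to minus infinity. *)
Lemma cauchy_estimate_Re f (f' : R[i] -> R[i]) (K s sg : R) :
  0 < sg -> sg < s -> (forall z, nc z < s -> cdiff f z (f' z)) ->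
  (forall z, nc z = sg -> nc (f z - f 0) <= K) ->
  sg * complex.Re (f' 0) <= K.
Proof.
move=> sg0 sgs fd fK.
suff approx e : 0 < e -> complex.Re (f' 0) <= K / sg + e.
  by rewrite mulrC -ler_pdivlMr //; apply/ler_addgt0Pr.
move=> e0.
have s0 := lt_trans sg0 sgs.
have [r r0 hr] : exists2 r : R, 0 < r & forall h, nc h < r ->
    nc (f h - f 0 - f' 0 * h) <= e * nc h.
  have [|r r0 hr] := fd 0 _ _ e0; first by rewrite nc0.
  by exists r => // h /hr; rewrite add0r.
(* [rho] is the radius of a circle on which the quotient is within [e] of
   [f' 0]; it is compared with the circle of radius [sg]. *)
pose rho := Num.min (r / 2) sg.
have rho0 : 0 < rho by rewrite lt_min sg0 divr_gt0.
have rhor : rho < r.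
  by rewrite gt_min ltr_pdivrMr // ltr_pMr // ltr1n.
have rhosg : rho <= sg by rewrite ge_min lexx orbT.
pose a := ln rho; pose b := ln sg.
have ea : expR a = rho by rewrite lnK.
have eb : expR b = sg by rewrite lnK.
have ab : a <= b by rewrite -ler_expR ea eb.
pose G w := (f (cexp w) - f 0) * cexp (- w).
have Gd x y : a <= x <= a + (b - a) -> exists d, cdiff G (x +i* y)%C d.
  rewrite [a + _]addrC subrK => /andP[_ xb].
  have zs : nc (cexp (x +i* y)%C) < s.
    by rewrite nc_circle; apply: le_lt_trans sgs; rewrite -eb ler_expR.
  eexists; apply: cdiffM.
    by apply: cdiff_subr; apply: cdiff_comp (cdiff_cexp _) (fd _ zs).
  by apply: (cdiff_comp (cdiff_opp _) (cdiff_cexp _)).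
pose P x y := complex.Im (G (x +i* y)%C); pose Q x y := complex.Re (G (x +i* y)%C).
pose T : R := pi *+ 2.
have T0 : 0 < T by rewrite mulrn_wgt0 // pi_gt0.
have ba0 : 0 <= b - a by rewrite subr_ge0.
have closed x y : a <= x <= a + (b - a) -> 0 <= y <= 0 + T ->
    exists px m qy, diff2 P x y px m /\ diff2 Q x y m qy.
  move=> /Gd - /(_ y)[d /cdiff_diff2 [PD QD]] _.
  by exists (complex.Im d), (complex.Re d), (- complex.Im d).
have := goursat ba0 (ltW T0) closed.
have [_ Qint] := closed_slices_integrable closed (lexx _) (lexx _) (lexx _) (lexx _).
rewrite /circulation [a + _]addrC subrK add0r in Qint *.
have periodic x : P x 0 - P x T = 0.
  rewrite /P /G cexp_2pi.
  have -> : cexp (- (x +i* T)%C) = cexp (- (x +i* 0)%C).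
    by rewrite /cexp /= cosN sinN cos2pi sin2pi oppr0 cos0 sin0.
  by rewrite subrr.
have -> : (fun x => P x 0 - P x T) = fun=> 0 by apply/funext.
rewrite seg_integral_cst // mul0r add0r => I0.
have bound y : Q b y - Q a y <= K / sg - (complex.Re (f' 0) - e).
  apply: lerB.
    apply: le_trans (ler_norm _) _; apply: le_trans (nc_ge_Re _) _.
    rewrite ComplexField.Normc.normcM [X in _ * X]nc_cexp /= expRN eb.
    by rewrite ler_pM2r ?invr_gt0 // fK // nc_circle eb.
  have : nc (G (a +i* y)%C - f' 0) <= e.
    have -> : G (a +i* y)%C - f' 0 =
       (f (cexp (a +i* y)%C) - f 0 - f' 0 * cexp (a +i* y)%C) * cexp (- (a +i* y)%C).
      rewrite /G [RHS]mulrBl -mulrA -cexpD subrr cexp0 mulr1.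
      by [].
    rewrite ComplexField.Normc.normcM [X in _ * X]nc_cexp /= expRN ea.
    rewrite ler_pdivrMr //.
    have := hr (cexp (a +i* y)%C); rewrite nc_circle ea; exact.
  move=> /(le_trans (nc_ge_Re _)).
  rewrite /Q; case: (G _) => u v; case: (f' 0) => p q /=.
  by rewrite ler_norml => /andP[]; lra.
have : 0 <= (K / sg - (complex.Re (f' 0) - e)) * T.
  rewrite -[leLHS]I0 -[X in _ * X]subr0 -seg_integral_cst ?(ltW T0) //.
  apply: ler_seg_integral => //; last exact: seg_integrable_cst.
  by apply: seg_integrableB; apply: Qint; rewrite ?lexx ?ab.
by rewrite pmulr_lge0 //; lra.
Qed.

(** Cauchy's estimate at the centre of a disc: multiplying [f] by the conjugate
    of [f' 0] makes the derivative real. *)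
Lemma cauchy_estimate f (f' : R[i] -> R[i]) (K s sg : R) :
  0 < sg -> sg < s -> (forall z, nc z < s -> cdiff f z (f' z)) ->
  (forall z, nc z = sg -> nc (f z - f 0) <= K) ->
  sg * nc (f' 0) <= K.
Proof.
move=> sg0 sgs fd fK; pose c := ((f' 0)^*)%C.
have K0 : 0 <= K.
  apply: le_trans (fK (sg%:C)%C _); first exact: nc_ge0.
  by rewrite nc_real gtr0_norm.
have [d0|d0] := eqVneq (nc (f' 0)) 0; first by rewrite d0 mulr0.
have dpos : 0 < nc (f' 0) by rewrite lt_neqAle eq_sym d0 nc_ge0.
have := @cauchy_estimate_Re (fun z => c * f z) (fun z => c * f' z)
  (nc (f' 0) * K) s sg sg0 sgs.
rewrite Re_conjM expr2 mulrCA ler_pM2l //; apply.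
  by move=> z zs; apply: cdiffZ; exact: fd.
move=> z zs; rewrite -mulrBr ComplexField.Normc.normcM nc_conj.
by rewrite ler_pM2l // fK.
Qed.

End CauchyEstimate.

(** * Derivatives in several variables *)

Section FrechetDerivative.
Variables (R : realType) (k : nat).
Implicit Types (f g : 'rV[R[i]]_k -> 'rV[R[i]]_k) (x y z u v w a : 'rV[R[i]]_k).
Implicit Types (A B : 'M[R[i]]_k) (df : 'rV[R[i]]_k -> 'M[R[i]]_k).

Lemma frechet_lip f z A : frechet f z A ->
  exists2 d : R, 0 < d & forall w, eucl_norm (w - z) < d ->
    eucl_norm (f w - f z) <= (op_norm A + 1) * eucl_norm (w - z).
Proof.
move=> fz; have [d d0 hd] := fz 1 ltr01; exists d => // w /hd.
rewrite [z + _]addrC subrK mul1r => fw.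
rewrite -[f w - f z](subrK ((w - z) *m A)).
rewrite mulrDl mul1r [leRHS]addrC.
by apply: le_trans (euclD _ _) _; rewrite lerD // op_normP.
Qed.

Lemma frechet_shift f w z A :
  frechet f (z + w) A -> frechet (fun x => f (x + w)) z A.
Proof.
move=> fz e /fz[d d0 hd]; exists d => // h /hd.
by rewrite [z + h + w]addrAC.
Qed.

Lemma frechetB f g z A B : frechet f z A -> frechet g z B ->
  frechet (fun x => f x - g x) z (A - B).
Proof.
move=> fz gz e e0; have e2 : 0 < e / 2 by rewrite divr_gt0.
have [d1 d10 h1] := fz _ e2; have [d2 d20 h2] := gz _ e2.
exists (Num.min d1 d2) => [|h]; first by rewrite lt_min d10.
rewrite lt_min => /andP[/h1 fh /h2 gh].
rewrite mulmxBr.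
have -> : f (z + h) - g (z + h) - (f z - g z) - (h *m A - h *m B) =
  (f (z + h) - f z - h *m A) - (g (z + h) - g z - h *m B).
  by move: (h *m A) (h *m B) => p q; apply/rowP => j; rewrite !mxE; ring.
by apply: le_trans (euclB _ _) _; rewrite [e]splitr mulrDl lerD.
Qed.

Lemma frechet_mulmx f z A B :
  frechet f z A -> frechet (fun x => f x *m B) z (A *m B).
Proof.
move=> fz e e0.
have B0 : 0 < op_norm B + 1 by rewrite ltr_wpDl ?op_norm_ge0.
have [d d0 hd] := fz _ (divr_gt0 e0 B0); exists d => // h /hd fh.
rewrite mulmxA -!mulmxBl; apply: le_trans (op_normP _ _) _.
apply: (@le_trans _ _ ((op_norm B + 1) * (e / (op_norm B + 1) * eucl_norm h))).
  by apply: ler_pM; rewrite ?eucl_ge0 ?op_norm_ge0 // lerDl.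
by rewrite mulrA [(op_norm B + 1) * _]mulrC divfK ?gt_eqF.
Qed.

Lemma frechet_id z : frechet idfun z 1%:M.
Proof.
move=> e e0; exists 1 => // h _.
by rewrite /= mulmx1 [z + h]addrC addrK subrr eucl0 mulr_ge0 ?eucl_ge0 // ltW.
Qed.

Lemma frechet_cst w z : frechet (fun=> w) z 0.
Proof.
move=> e e0; exists 1 => // h _.
by rewrite mulmx0 !subrr eucl0 mulr_ge0 ?eucl_ge0 // ltW.
Qed.

(** A bisection proof: a midpoint split adds the bounds, and near [t] the bound
    for an interval containing [t] is the sum of those from [t] to its ends.  No
    continuity of the derivative enters. *)
Lemma segment_lipschitz (g : R -> 'rV[R[i]]_k) (L : R) :
  (forall t, 0 <= t <= 1 -> forall e, 0 < e -> exists2 d, 0 < d &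
     forall s, `|s - t| < d -> eucl_norm (g s - g t) <= (L + e) * `|s - t|) ->
  eucl_norm (g 1 - g 0) <= L.
Proof.
move=> gL; apply/ler_addgt0Pr => e e0.
have := @rect_bisection R (fun b _ l _ =>
  eucl_norm (g (b + l) - g b) <= (L + e) * l) 0 0 1 0.
rewrite /= add0r mulr1; apply => //.
  move=> a c w h _ q1 q2 _ _.
  have aw : a + w / 2 + w / 2 = a + w by rewrite -addrA -splitr.
  rewrite aw in q2; rewrite [w]splitr mulrDr -splitr.
  apply: le_trans (eucl_triangle (g (a + w / 2)) _ _) _.
  by rewrite lerD.
move=> t c t01 _; have [d d0 hd] := gL t t01 e e0; exists d => //.
move=> a c' w h _ /andP[at_ ta] _ wd _.
apply: le_trans (eucl_triangle (g t) _ _) _.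
have nt : 0 <= t - a by rewrite subr_ge0.
have nw : 0 <= a + w - t by rewrite subr_ge0.
have h1 : eucl_norm (g (a + w) - g t) <= (L + e) * (a + w - t).
  have := hd (a + w); rewrite (ger0_norm nw); apply.
  by apply: le_lt_trans wd; rewrite lerBlDr addrC lerD2l.
have h2 : eucl_norm (g t - g a) <= (L + e) * (t - a).
  rewrite eucl_distC; have := hd a; rewrite distrC (ger0_norm nt); apply.
  by apply: le_lt_trans wd; rewrite lerBlDr addrC.
apply: le_trans (lerD h1 h2) _; rewrite -mulrDr addrA subrK.
by rewrite [a + w]addrC addrK.
Qed.

Lemma mean_value_inequality f (df : 'rV[R[i]]_k -> 'M[R[i]]_k) x y (L : R) :
  (forall t : R, 0 <= t <= 1 ->
    let z := x + (t%:C)%C *: (y - x) in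
    frechet f z (df z) /\ eucl_norm ((y - x) *m df z) <= L) ->
  eucl_norm (f y - f x) <= L.
Proof.
move=> fxy; pose p (t : R) := x + (t%:C)%C *: (y - x).
have -> : f y = f (p 1) by rewrite /p scale1r addrC subrK.
have -> : f x = f (p 0) by rewrite /p scale0r addr0.
apply: (@segment_lipschitz (f \o p)) => t t01 e e0.
have [fz fL] := fxy t t01; rewrite -/(p t) in fz fL.
have n0 : 0 < eucl_norm (y - x) + 1 by rewrite ltr_wpDl ?eucl_ge0.
have [d d0 hd] := fz _ (divr_gt0 e0 n0).
exists (d / (eucl_norm (y - x) + 1)) => [|s sd]; first by rewrite divr_gt0.
have step : p s = p t + ((s - t)%:C)%C *: (y - x).
  by rewrite /p -addrA -scalerDl -rmorphD /= [t + _]addrC subrK.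
have nstep : eucl_norm (((s - t)%:C)%C *: (y - x)) <=
    `|s - t| * (eucl_norm (y - x) + 1).
  by rewrite euclZr ler_wpM2l // lerDl.
have := hd (((s - t)%:C)%C *: (y - x)); rewrite -step => hs.
rewrite /= -[f (p s) - f (p t)](subrK (((s - t)%:C)%C *: (y - x) *m df (p t))).
apply: le_trans (euclD _ _) _; rewrite mulrDl addrC lerD //.
  by rewrite -scalemxAl euclZr mulrC ler_wpM2r.
apply: le_trans (hs _) _.
  by apply: le_lt_trans nstep _; rewrite -ltr_pdivlMr.
apply: le_trans (ler_wpM2l _ nstep) _; first by rewrite divr_ge0 // ltW.
by rewrite mulrCA divfK ?gt_eqF // mulrC.
Qed.

Lemma eucl_ball_segment a (r : R) x y (t : R) : 0 <= t <= 1 ->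
  eucl_ball a r x -> eucl_ball a r y ->
  eucl_ball a r (x + (t%:C)%C *: (y - x)).
Proof.
rewrite /eucl_ball /= => /andP[t0 t1] xa ya.
have -> : x + (t%:C)%C *: (y - x) - a =
    ((1 - t)%:C)%C *: (x - a) + (t%:C)%C *: (y - a).
  rewrite rmorphB /= scalerBl scale1r !scalerBr opprB.
  apply/rowP => j; rewrite !mxE; ring.
apply: le_lt_trans (euclD _ _) _; rewrite !euclZr.
rewrite (ger0_norm t0) ger0_norm ?subr_ge0 //.
have [->|tn0] := eqVneq t 0; first by rewrite subr0 mul1r mul0r addr0.
have tpos : 0 < t by rewrite lt_neqAle eq_sym tn0.
have -> : r = (1 - t) * r + t * r by ring.
apply: ler_ltD; last by rewrite ltr_pM2l.
by rewrite ler_wpM2l ?subr_ge0 // ltW.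
Qed.

Definition holomorphic_with f (df : 'rV[R[i]]_k -> 'M[R[i]]_k) a (r : R) :=
  forall z, eucl_ball a r z -> frechet f z (df z).

Lemma mean_value_ball f df a (r : R) (L : R) x y :
  holomorphic_with f df a r -> eucl_ball a r x -> eucl_ball a r y ->
  (forall z, eucl_ball a r z -> eucl_norm ((y - x) *m df z) <= L) ->
  eucl_norm (f y - f x) <= L.
Proof.
move=> fh xa ya fL; apply: (@mean_value_inequality f df) => t t01 z.
have za : eucl_ball a r z by exact: eucl_ball_segment.
by split; [exact: fh|exact: fL].
Qed.

Lemma eucl_ball_sub a b (r s : R) :
  eucl_norm (b - a) + s <= r -> eucl_ball b s `<=` eucl_ball a r.
Proof.
rewrite /eucl_ball => h z /= zb; apply: lt_le_trans h.
by apply: le_lt_trans (eucl_triangle b _ _) _; rewrite addrC ltrD2l.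
Qed.

Lemma eucl_ball_center a (r : R) : 0 < r -> eucl_ball a r a.
Proof. by rewrite /eucl_ball /= subrr eucl0. Qed.

Lemma frechet_line f x u (c : R[i]) A j : frechet f (x + c *: u) A ->
  cdiff (fun s => f (x + s *: u) 0 j) c ((u *m A) 0 j).
Proof.
move=> fz e e0.
have n0 : 0 < eucl_norm u + 1 by rewrite ltr_wpDl ?eucl_ge0.
have [d d0 hd] := fz _ (divr_gt0 e0 n0).
exists (d / (eucl_norm u + 1)) => [|h hn]; first by rewrite divr_gt0.
have nh : eucl_norm (h *: u) <= nc h * (eucl_norm u + 1).
  by rewrite euclZ ler_wpM2l ?nc_ge0 // lerDl.
have := hd (h *: u).
rewrite -[x + c *: u + h *: u]addrA -scalerDl => hs.
have /hs fh : eucl_norm (h *: u) < d.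
  by apply: le_lt_trans nh _; rewrite -ltr_pdivlMr.
have := nc_coord_le (f (x + (c + h) *: u) - f (x + c *: u) - (h *: u) *m A) j.
rewrite -scalemxAl !mxE [h * _]mulrC => /le_trans; apply.
rewrite scalemxAl; apply: le_trans fh _.
apply: le_trans (ler_wpM2l _ nh) _; first by rewrite divr_ge0 // ltW.
by rewrite mulrCA divfK ?gt_eqF // mulrC.
Qed.

(** The scalar estimate applied to each coordinate of [f] along the complex line
    of direction [u]; summing the coordinates costs the factor [k]. *)
Lemma cauchy_estimate_ball f df a (r K : R) u : 0 < r ->
  holomorphic_with f df a r ->
  (forall z, eucl_ball a r z -> eucl_norm (f z - f a) <= K) ->
  eucl_norm (u *m df a) <= k%:R * (2 * K / r) * eucl_norm u.
Proof.
move=> r0 fh fK.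
have [->|u0] := eqVneq u 0; first by rewrite mul0mx eucl0 mulr0.
have n0 := eucl_gt0 u0.
pose s := r / eucl_norm u.
have s0 : 0 < s by rewrite divr_gt0.
have ss : s / 2 < s by rewrite ltr_pdivrMr // ltr_pMr // ltr1n.
have inball (z : R[i]) : nc z < s -> eucl_ball a r (a + z *: u).
  by move=> zs; rewrite /eucl_ball /= [a + _]addrC addrK euclZ -ltr_pdivlMr.
have coord j : nc ((u *m df a) 0 j) <= 2 * K / r * eucl_norm u.
  have := @cauchy_estimate _ (fun z : R[i] => f (a + z *: u) 0 j)
    (fun z : R[i] => (u *m df (a + z *: u)) 0 j) K s (s / 2).
  rewrite scale0r addr0 => H.
  have {}H : s / 2 * nc ((u *m df a) 0 j) <= K.
    apply: H => //; first by rewrite divr_gt0.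
      by move=> z /inball/fh; exact: frechet_line.
    move=> z zs; have := nc_coord_le (f (a + z *: u) - f a) j.
    rewrite !mxE => /le_trans; apply; apply: fK; apply: inball.
    by rewrite zs.
  have -> : 2 * K / r * eucl_norm u = K / (s / 2).
    by rewrite /s; field; rewrite !gt_eqF.
  by rewrite ler_pdivlMr ?divr_gt0 // mulrC.
apply: le_trans (eucl_le_sum _) _.
apply: le_trans (ler_sum _ (fun j _ => coord j)) _.
by rewrite sumr_const card_ord -[leLHS]mulr_natl -[leRHS]mulrA.
Qed.

(** A bounded derivative is Lipschitz near the centre: the difference quotients
    [(f (x + t v) - f x) / t] are holomorphic and bounded, so that their derivatives
    are controlled by Cauchy's estimate, and they converge to [v *m df x]. *)
Lemma derivative_lipschitz f df a (r M : R) x v : 0 < r ->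
  holomorphic_with f df a r ->
  (forall z w, eucl_ball a r z -> eucl_norm (w *m df z) <= M * eucl_norm w) ->
  eucl_ball a (r / 4) x ->
  eucl_norm (v *m df x - v *m df a) <=
    k%:R * (16 * M / r) * eucl_norm v * eucl_norm (x - a).
Proof.
move=> r0 fh fM xa; apply/ler_addgt0Pr => e e0.
have n0 : 0 < eucl_norm v + 1 by rewrite ltr_wpDl ?eucl_ge0.
have r4 : 0 < r / 4 by rewrite divr_gt0.
have a4 : eucl_ball a (r / 4) a by exact: eucl_ball_center.
have xr : eucl_ball a r x.
  by apply: lt_trans xa _; rewrite ltr_pdivrMr // ltr_pMr // ltr1n.
have ar : eucl_ball a r a by exact: eucl_ball_center.
have e1 : 0 < e / 2 / (eucl_norm v + 1) by rewrite !divr_gt0.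
have [d1 d10 h1] := fh x xr _ e1; have [d2 d20 h2] := fh a ar _ e1.
(* [t v] must stay in the radii where both expansions, at [x] and at [a], are
   accurate up to [e / 2], and move points by less than [r / 4]. *)
pose t := Num.min (r / 4) (Num.min d1 d2) / (eucl_norm v + 1) / 2.
have t0 : 0 < t by rewrite !divr_gt0 // !lt_min r4 d10.
have tv : eucl_norm ((t%:C)%C *: v) < Num.min (r / 4) (Num.min d1 d2).
  rewrite euclZr gtr0_norm // /t; set m := Num.min _ _.
  have m0 : 0 < m by rewrite !lt_min r4 d10.
  apply: (@le_lt_trans _ _ (m / 2)).
    rewrite mulrAC ler_pM2r ?invr_gt0 // -mulrA ler_piMr ?(ltW m0) //.
    by rewrite mulrC ler_pdivrMr // mul1r lerDl.
  by rewrite ltr_pdivrMr // ltr_pMr // ltr1n.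
rewrite !lt_min in tv; case/and3P: tv => tvr tv1 tv2.
pose D z := ((t^-1)%:C)%C *: (f (z + (t%:C)%C *: v) - f z).
pose D' z := ((t^-1)%:C)%C *: (df (z + (t%:C)%C *: v) - df z).
have sub2 : eucl_ball a (r / 2) `<=` eucl_ball a r.
  by apply: eucl_ball_sub; rewrite subrr eucl0 add0r ler_pdivrMr // ler_pMr // ler1n.
have shift2 z : eucl_ball a (r / 2) z -> eucl_ball a r (z + (t%:C)%C *: v).
  move=> za; rewrite /eucl_ball /= addrAC.
  apply: le_lt_trans (euclD _ _) _; rewrite [r]splitr; apply: ltrD => //.
  by apply: lt_trans tvr _; rewrite ltr_pM2l // ltf_pV2 ?posrE // ltr_nat.
have Dh : holomorphic_with D D' a (r / 2).
  move=> z za e' e'0.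
  have te : 0 < t * e' by rewrite mulr_gt0.
  have := frechetB (frechet_shift (fh _ (shift2 z za))) (fh _ (sub2 z za)).
  move=> /(_ _ te)[d d0 hd]; exists d => // h /hd hh.
  rewrite /D /D' -scalemxAr -!scalerBr euclZr ger0_norm ?invr_ge0 ?(ltW t0) //.
  by rewrite mulrC ler_pdivrMr // mulrC mulrA.
have DM z : eucl_ball a (r / 2) z -> eucl_norm (D z) <= M * eucl_norm v.
  move=> za; rewrite euclZr ger0_norm ?invr_ge0 ?(ltW t0) //.
  rewrite mulrC ler_pdivrMr // mulrC.
  apply: (mean_value_ball fh (sub2 _ za) (shift2 _ za)) => w wa.
  apply: le_trans (fM _ _ wa) _.
  by rewrite [z + _]addrC addrK euclZr (gtr0_norm t0) mulrCA.
have sub4 z : eucl_ball a (r / 4) z -> eucl_ball z (r / 4) `<=` eucl_ball a (r / 2).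
  move=> za; apply: eucl_ball_sub.
  have -> : r / 2 = r / 4 + r / 4 by field.
  by rewrite lerD2r ltW.
have DL z w : eucl_ball a (r / 4) z ->
    eucl_norm (w *m D' z) <= k%:R * (16 * M / r) * eucl_norm v * eucl_norm w.
  move=> za; have zr := sub4 z za.
  have := @cauchy_estimate_ball D D' z (r / 4) (2 * M * eucl_norm v) w r4.
  have -> : k%:R * (2 * (2 * M * eucl_norm v) / (r / 4)) * eucl_norm w =
    k%:R * (16 * M / r) * eucl_norm v * eucl_norm w by field; rewrite gt_eqF.
  apply; first by move=> y /zr; exact: Dh.
  move=> y /zr yz; apply: le_trans (euclB _ _) _.
  have -> : 2 * M * eucl_norm v = M * eucl_norm v + M * eucl_norm v by ring.
  by apply: lerD; apply: DM => //; apply: zr; exact: eucl_ball_center.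
have Dxa : eucl_norm (D x - D a) <=
    k%:R * (16 * M / r) * eucl_norm v * eucl_norm (x - a).
  apply: (@mean_value_ball D D' a (r / 4)) => //.
    move=> z za; apply: Dh.
    by apply: (sub4 a) => //; rewrite /eucl_ball.
  by move=> z za; exact: DL.
have near_D (z : 'rV[R[i]]_k) d :
    (forall h, eucl_norm h < d -> eucl_norm (f (z + h) - f z - h *m df z) <=
       e / 2 / (eucl_norm v + 1) * eucl_norm h) ->
    eucl_norm ((t%:C)%C *: v) < d -> eucl_norm (D z - v *m df z) <= e / 2.
  move=> hd /hd hh.
  have -> : D z - v *m df z = ((t^-1)%:C)%C *:
      (f (z + (t%:C)%C *: v) - f z - ((t%:C)%C *: v) *m df z).
    rewrite [RHS]scalerBr -scalemxAl scalerA -rmorphM mulVf ?gt_eqF //.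
    by rewrite scale1r.
  rewrite euclZr ger0_norm ?invr_ge0 ?(ltW t0) // mulrC ler_pdivrMr //.
  apply: le_trans hh _; rewrite euclZr (gtr0_norm t0) -mulrA ler_pM2l ?divr_gt0 //.
  by rewrite mulrC -mulrA ler_piMr ?(ltW t0) // ler_pdivrMr // mul1r lerDl.
have hx := near_D x d1 h1 tv1; have ha := near_D a d2 h2 tv2.
have -> : v *m df x - v *m df a =
    (D x - D a) - ((D x - v *m df x) - (D a - v *m df a)).
  by move: (v *m df x) (v *m df a) => p q; apply/rowP => j; rewrite !mxE; ring.
apply: le_trans (euclB _ _) _; apply: lerD; first exact: Dxa.
by rewrite [leRHS]splitr; exact: le_trans (euclB _ _) (lerD hx ha).
Qed.

(** Differentiability at [a] alone bounds [f] near [a], and Cauchy's estimate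
    turns this into a bound on the derivative at all points nearby. *)
Lemma derivative_locally_bounded f df a (r : R) : 0 < r ->
  holomorphic_with f df a r ->
  exists2 s : R, 0 < s & exists K : R, forall z, eucl_ball a s z ->
    op_norm (df z) <= K.
Proof.
move=> r0 fh; have [d d0 hd] := frechet_lip (fh a (eucl_ball_center a r0)).
pose m := Num.min r d; have m0 : 0 < m by rewrite lt_min r0.
pose L := (op_norm (df a) + 1) * m.
exists (m / 2); first by rewrite divr_gt0.
exists (k%:R * (2 * (2 * L) / (m / 2))) => z za.
have zm : eucl_ball z (m / 2) `<=` eucl_ball a m.
  by apply: eucl_ball_sub; rewrite [leRHS]splitr lerD2r ltW.
have fL w : eucl_ball a m w -> eucl_norm (f w - f a) <= L.
  move=> wm; apply: le_trans (hd w _) _.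
    by apply: lt_le_trans wm _; rewrite ge_min lexx orbT.
  by apply: ler_wpM2l; [rewrite addr_ge0 ?op_norm_ge0|exact: ltW].
apply: op_norm_le => u u1.
have m2 : 0 < m / 2 by rewrite divr_gt0.
have bnd w : eucl_ball z (m / 2) w -> eucl_norm (f w - f z) <= 2 * L.
  move=> /zm wm; apply: le_trans (eucl_triangle (f a) _ _) _.
  rewrite mulr_natl mulr2n lerD ?fL // eucl_distC fL //.
  by apply: zm; exact: eucl_ball_center.
apply: le_trans (@cauchy_estimate_ball f df z (m / 2) (2 * L) u m2 _ bnd) _.
  move=> w /zm wm; apply: fh; apply: lt_le_trans wm _.
  by rewrite ge_min lexx.
apply: ler_piMr => //; rewrite mulr_ge0 // divr_ge0 ?(ltW m2) //.
by rewrite !mulr_ge0 // ?addr_ge0 ?op_norm_ge0 // ltW.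
Qed.

End FrechetDerivative.

(** * Choice of the centre *)

Section Completeness.
Variable R : realType.

Lemma geometric_limit (x : nat -> R) (c : R) : 0 <= c ->
  (forall n, `|x n.+1 - x n| <= c / 2 ^+ n.+1) ->
  exists l, forall n, `|x n - l| <= c / 2 ^+ n.
Proof.
move=> c0 step.
have half n : c / 2 ^+ n = c / 2 ^+ n.+1 + c / 2 ^+ n.+1.
  by rewrite exprS; field; rewrite expf_neq0.
have twice n : 2 * c / 2 ^+ n = c / 2 ^+ n + c / 2 ^+ n by ring.
have [|n|l hl] := @nested_halving R (fun n => x n - c / 2 ^+ n) (2 * c).
- by rewrite mulr_ge0.
- have := step n; rewrite twice (half n) ler_norml.
  by clear; set u := c / _ => /andP[h1 h2]; apply/andP; split; lra.
- exists l => n; have := hl n; rewrite twice ler_norml.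
  by clear; set u := c / _ => /andP[h1 h2]; apply/andP; split; lra.
Qed.

Variable k : nat.
Implicit Types (z : nat -> 'rV[R[i]]_k).

Lemma eucl_geometric_step z (c : R) : 0 <= c ->
  (forall n, eucl_norm (z n.+1 - z n) <= c / 2 ^+ n.+1) ->
  forall n m, eucl_norm (z (n + m)%N - z n) <= c / 2 ^+ n - c / 2 ^+ (n + m).
Proof.
move=> c0 step n; elim=> [|m IH]; first by rewrite addn0 !subrr eucl0.
rewrite addnS; apply: le_trans (eucl_triangle (z (n + m)%N) _ _) _.
apply: le_trans (lerD (step _) IH) _.
have -> : c / 2 ^+ (n + m) = c / 2 ^+ (n + m).+1 + c / 2 ^+ (n + m).+1.
  by rewrite exprS; field; rewrite expf_neq0.
set u := c / 2 ^+ (n + m).+1; set v := c / 2 ^+ n.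
by have -> : u + (v - (u + u)) = v - u by ring.
Qed.

(** Coordinatewise limits only give the bound up to a factor depending on [k];
    passing to the limit in [eucl_geometric_step] removes it. *)
Lemma eucl_geometric_limit z (c : R) : 0 <= c ->
  (forall n, eucl_norm (z n.+1 - z n) <= c / 2 ^+ n.+1) ->
  exists l, forall n, eucl_norm (z n - l) <= c / 2 ^+ n.
Proof.
move=> c0 step.
have coordRe j : exists l, forall n, `|complex.Re (z n 0 j) - l| <= c / 2 ^+ n.
  apply: geometric_limit => // n; apply: le_trans (step n).
  apply: le_trans (nc_coord_le _ j); apply: le_trans (nc_ge_Re _).
  by rewrite !mxE; case: (z n.+1 0 j) => ? ?; case: (z n 0 j).
have coordIm j : exists l, forall n, `|complex.Im (z n 0 j) - l| <= c / 2 ^+ n.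
  apply: geometric_limit => // n; apply: le_trans (step n).
  apply: le_trans (nc_coord_le _ j); apply: le_trans (nc_ge_Im _).
  by rewrite !mxE; case: (z n.+1 0 j) => ? ?; case: (z n 0 j).
have [lr hr] := choice coordRe; have [li hi] := choice coordIm.
pose l : 'rV[R[i]]_k := \row_j (lr j +i* li j)%C.
have rough n : eucl_norm (z n - l) <= k%:R * (2 * c) / 2 ^+ n.
  apply: le_trans (eucl_le_sum _) _.
  have coord j : nc ((z n - l) 0 j) <= 2 * c / 2 ^+ n.
    rewrite !mxE; apply: le_trans (nc_le_ReIm _) _.
    have := hr j n; have := hi j n; case: (z n 0 j) => p q /= h1 h2.
    by rewrite mulr_natl mulr2n mulrDl lerD.
  apply: le_trans (ler_sum _ (fun j _ => coord j)) _.
  by rewrite sumr_const card_ord -[leLHS]mulr_natl -[leRHS]mulrA.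
exists l => n; apply/ler_addgt0Pr => e e0.
have [m hm] := divr_exp2_lt (k%:R * (2 * c)) e0.
apply: le_trans (eucl_triangle (z (n + m)%N) _ _) _; apply: lerD.
  rewrite eucl_distC; apply: le_trans (eucl_geometric_step c0 step n m) _.
  by rewrite gerBl divr_ge0 // exprn_ge0.
apply: le_trans (rough _) _; apply: ltW; apply: le_lt_trans hm.
apply: ler_wpM2l; first by rewrite !mulr_ge0.
by rewrite lef_pV2 ?posrE ?exprn_gt0 // ler_weXn2l ?ler1n // leq_addl.
Qed.

End Completeness.

Section Selection.
Variables (R : realType) (k : nat).
Implicit Types (f : 'rV[R[i]]_k -> 'rV[R[i]]_k) (df : 'rV[R[i]]_k -> 'M[R[i]]_k).

(** Bloch's choice of centre.  If no such ball existed, jumping repeatedly to a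
    point of the ball of radius [2 ^- (n + 2)] where the norm of the derivative has more
    than doubled would produce a sequence converging inside the unit ball, near
    whose limit the derivative is unbounded. *)
Lemma derivative_doubling_ball f df :
  holomorphic_with f df 0 1 -> 1 <= op_norm (df 0) ->
  exists a (r : R), [/\ 0 < r, eucl_ball a r `<=` eucl_ball 0 1,
    4^-1 <= r * op_norm (df a) &
    forall z, eucl_ball a r z -> op_norm (df z) <= 2 * op_norm (df a)].
Proof.
move=> fh N0; apply: contrapT => none.
have two_gt0 n : 0 < 2 ^+ n :> R by rewrite exprn_gt0.
pose rad n : R := 2^-1 / 2 ^+ n.+1.
have rad0 n : 0 < rad n by rewrite divr_gt0.
have radE n : 2^-1 / 2 ^+ n = rad n + rad n.
  by rewrite /rad exprS; field; rewrite expf_neq0.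
pose good (p : 'rV[R[i]]_k * nat) :=
  2 ^+ p.2 <= op_norm (df p.1) /\ eucl_norm p.1 <= 2^-1 - 2^-1 / 2 ^+ p.2.
pose next p q := good p ->
  [/\ good q, q.2 = p.2.+1 & eucl_norm (q.1 - p.1) <= rad p.2].
have ex_next p : {q | next p q}.
  apply: cid; have [gp|ngp] := pselect (good p); last by exists p.
  case: p gp => z n [/= zN zn]; apply: contrapT => noq; apply: none.
  exists z, (rad n); split=> //.
  - apply: eucl_ball_sub; rewrite subr0.
    apply: (@le_trans _ _ 2^-1); last by rewrite invf_le1 // ler1n.
    by rewrite -lerBrDr; apply: le_trans zn _; rewrite radE lerB // lerDl ltW.
  - apply: (@le_trans _ _ (rad n * 2 ^+ n)); last by rewrite ler_pM2l.
    have -> : rad n * 2 ^+ n = 4^-1 by rewrite /rad exprS; field; rewrite expf_neq0.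
    exact: lexx.
  - move=> w /ltW wz; rewrite leNgt; apply/negP => big; apply: noq.
    exists (w, n.+1) => _; split; [split; cbn [fst snd]|reflexivity|exact: wz].
      by rewrite exprS; apply: ltW; apply: le_lt_trans big; rewrite ler_pM2l.
    rewrite -[w](subrK z); apply: le_trans (euclD _ _) _.
    apply: le_trans (lerD wz zn) _; rewrite radE /rad.
    set u := 2^-1 / _.
    by have -> : u + (2^-1 - (u + u)) = 2^-1 - u by ring.
have [s [s0 sS]] := dependent_choice ex_next (0, 0%N).
have goodS n : good (s n) /\ (s n).2 = n.
  elim: n => [|n [gn nE]].
    by rewrite s0; split=> //; split; rewrite /= ?expr0 // eucl0 divr1 subrr.
  by have [gn1 n1E _] := sS n gn; rewrite n1E nE.
have stepS n : eucl_norm ((s n.+1).1 - (s n).1) <= 2^-1 / 2 ^+ n.+1.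
  by have [gn nE] := goodS n; have [_ _] := sS n gn; rewrite nE.
have half_ge0 : 0 <= 2^-1 :> R by rewrite invr_ge0.
have [l hl] := eucl_geometric_limit half_ge0 stepS.
have l1 : eucl_norm l <= 2^-1.
  by have := hl 0%N; rewrite s0 /= expr0 divr1 sub0r euclN.
have fl : holomorphic_with f df l 2^-1.
  move=> z zl; apply: fh; move: z zl; apply: eucl_ball_sub.
  by rewrite subr0 [leRHS]splitr mul1r lerD2r.
have [|t t0 [K hK]] := derivative_locally_bounded _ fl; first by rewrite invr_gt0.
have K0 : 0 < K + 1.
  by rewrite ltr_wpDl //; apply: le_trans (hK l (eucl_ball_center l t0)); exact: op_norm_ge0.
have m0 : 0 < Num.min t (K + 1)^-1 by rewrite lt_min t0 invr_gt0.
have [n] := divr_exp2_lt 1 m0.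
rewrite lt_min mul1r => /andP[nt nK].
have [[Nn _] nE] := goodS n; rewrite nE in Nn.
have near_l : eucl_ball l t (s n).1.
  apply: le_lt_trans (hl n) _; apply: le_lt_trans nt.
  by rewrite ler_piMl ?invr_ge0 ?(ltW (two_gt0 n)) // invf_le1 // ler1n.
have := le_trans Nn (hK _ near_l); rewrite leNgt => /negP; apply.
by rewrite ltf_pV2 ?posrE // in nK; apply: lt_trans nK; rewrite ltrDl.
Qed.

End Selection.

(** * The quantitative inverse function theorem and the conclusion *)

Section QuantitativeInverse.
Variables (R : realType) (k : nat).
Variables (f : 'rV[R[i]]_k -> 'rV[R[i]]_k) (df : 'rV[R[i]]_k -> 'M[R[i]]_k).
Variables (a : 'rV[R[i]]_k) (r beta : R) (B : 'M[R[i]]_k).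
Hypotheses (r0 : 0 < r) (beta0 : 0 < beta) (fh : holomorphic_with f df a r).
Hypothesis AB : df a *m B = 1%:M.
Hypothesis B_le : forall v, eucl_norm (v *m B) <= beta * eucl_norm v.
Hypothesis df_near : forall x v, eucl_ball a r x ->
  eucl_norm ((v *m df x - v *m df a) *m B) <= 2^-1 * eucl_norm v.
Implicit Types (x y v : 'rV[R[i]]_k).

(** The Newton map for [f x = y] with the inverse of the derivative frozen at the
    centre; its derivative [1 - df x B] has norm at most one half. *)
Let newton y x := x - (f x - y) *m B.

Lemma newton_contraction y x x' : eucl_ball a r x -> eucl_ball a r x' ->
  eucl_norm (newton y x - newton y x') <= 2^-1 * eucl_norm (x - x').
Proof.
move=> xa x'a.
apply: (@mean_value_ball _ _ (newton y) (fun z => 1%:M - (df z - 0) *m B) a r) => //.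
  move=> z za; apply: frechetB; first exact: frechet_id.
  by apply: frechet_mulmx; apply: frechetB; [exact: fh|exact: frechet_cst].
move=> z za; move: (x - x') (df_near (x - x') za) => v.
by rewrite subr0 mulmxBr mulmx1 mulmxBl -!mulmxA AB mulmx1 eucl_distC.
Qed.

(** [x - x'] differs from the increment of [f] times [B] by an increment of the
    Newton map, which is at most half of it. *)
Lemma inverse_lipschitz x x' : eucl_ball a r x -> eucl_ball a r x' ->
  eucl_norm (x - x') <= 2 * beta * eucl_norm (f x - f x').
Proof.
move=> xa x'a; have := newton_contraction 0 xa x'a.
have -> : newton 0 x - newton 0 x' = (x - x') - (f x - f x') *m B.
  rewrite /newton !subr0 mulmxBl.
  by move: (f x *m B) (f x' *m B) => p q; apply/rowP => j; rewrite !mxE; ring.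
set h := x - x'; set w := (f x - f x') *m B => hw.
have wb : eucl_norm w <= beta * eucl_norm (f x - f x') by exact: B_le.
have : eucl_norm h <= 2^-1 * eucl_norm h + beta * eucl_norm (f x - f x').
  rewrite -[h in X in X <= _](subrK w); apply: le_trans (euclD _ _) _.
  exact: lerD.
by move: (eucl_norm h) (eucl_norm _) => p q; lra.
Qed.

(** The radius [r / (4 beta)] makes the first Newton step from [a] at most
    [r / 4], so that the iterates, whose steps halve, stay within [r / 2]. *)
Lemma newton_surjective (rho : R) y : rho <= r / (4 * beta) ->
  eucl_ball (f a) rho y -> exists2 x, eucl_ball a r x & f x = y.
Proof.
move=> rho_le ya; pose x n := iter n (newton y) a.
have b4 : 0 < 4 * beta by rewrite mulr_gt0.
have first_step : eucl_norm (newton y a - a) <= r / 4.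
  rewrite /newton addrAC subrr add0r euclN; apply: le_trans (B_le _) _.
  rewrite eucl_distC; apply: (@le_trans _ _ (beta * (r / (4 * beta)))).
    by rewrite ler_pM2l //; apply: le_trans (ltW ya) rho_le.
  have -> : beta * (r / (4 * beta)) = r / 4 by field; rewrite gt_eqF.
  exact: lexx.
have r2 : 0 <= r / 2 by rewrite divr_ge0 // ltW.
have r2r : r / 2 < r by rewrite ltr_pdivrMr // ltr_pMr // ltr1n.
have inball v : eucl_norm (v - a) <= r / 2 -> eucl_ball a r v.
  by move=> va; rewrite /eucl_ball /=; apply: le_lt_trans r2r.
have main n : eucl_norm (x n.+1 - x n) <= r / 2 / 2 ^+ n.+1 /\
    eucl_norm (x n - a) <= r / 2 - r / 2 / 2 ^+ n.
  elim: n => [|n [IH1 IH2]].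
    split; last by rewrite /= subrr eucl0 expr0 divr1 subrr.
    by rewrite expr1; apply: le_trans first_step _; rewrite -mulrA -invfM -natrM.
  set u := r / 2 / 2 ^+ n.+1 in IH1 *.
  have uE : r / 2 / 2 ^+ n = u + u.
    by rewrite /u exprS; field; rewrite expf_neq0.
  have u0 : 0 <= u by rewrite divr_ge0 // exprn_ge0.
  have xa : eucl_norm (x n - a) <= r / 2.
    by apply: le_trans IH2 _; rewrite gerBl uE addr_ge0.
  have xa' : eucl_norm (x n.+1 - a) <= r / 2 - u.
    apply: le_trans (eucl_triangle (x n) _ _) _; apply: le_trans (lerD IH1 IH2) _.
    by rewrite uE; have -> : u + (r / 2 - (u + u)) = r / 2 - u by ring.
  split=> //.
  have -> : r / 2 / 2 ^+ n.+2 = 2^-1 * u.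
    by rewrite /u [_ ^+ n.+2]exprS; field; rewrite expf_neq0.
  have xa'' : eucl_norm (x n.+1 - a) <= r / 2.
    by apply: le_trans xa' _; rewrite gerBl.
  apply: le_trans (newton_contraction y (inball _ xa'') (inball _ xa)) _.
  by rewrite ler_pM2l ?invr_gt0.
have [l hl] := eucl_geometric_limit r2 (fun n => (main n).1).
have la : eucl_ball a r l.
  apply: inball; have := hl 0%N; rewrite expr0 divr1 eucl_distC.
  exact.
exists l => //.
have fixed : newton y l = l.
  apply/eqP; rewrite -subr_eq0; apply/eqP/eucl0_eq0/eqP.
  rewrite eq_le eucl_ge0 andbT; apply/ler_addgt0Pr => e e0; rewrite add0r.
  have [n hn] := divr_exp2_lt (r / 2 * 2) e0.
  have xn : eucl_ball a r (x n).
    apply: inball; apply: le_trans (main n).2 _.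
    by rewrite gerBl divr_ge0 // exprn_ge0.
  apply: le_trans (eucl_triangle (x n.+1) _ _) _.
  apply: le_trans (ltW hn); rewrite mulrAC mulr_natr mulr2n; apply: lerD.
    apply: le_trans (newton_contraction y la xn) _.
    rewrite eucl_distC; apply: le_trans (hl n).
    by rewrite ler_piMl ?eucl_ge0 // invf_le1 // ler1n.
  apply: le_trans (hl n.+1) _; apply: ler_wpM2l => //.
  by rewrite lef_pV2 ?posrE ?exprn_gt0 // ler_weXn2l // ler1n.
have : (f l - y) *m B = 0.
  by rewrite -[LHS](subKr l) -/(newton y l) fixed subrr.
move=> /(congr1 (mulmx^~ (df a))).
rewrite mul0mx -mulmxA (mulmx1C AB) mulmx1 => /eqP.
by rewrite subr_eq0 => /eqP.
Qed.

Lemma open_preimage (rho : R) :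
  open [set x | eucl_ball a r x /\ eucl_ball (f a) rho (f x)].
Proof.
rewrite openE => x /= [xa fx]; rewrite /interior; apply/nbhs_euclP.
have [d d0 hd] := frechet_lip (fh xa).
have K0 : 0 < op_norm (df x) + 1 by rewrite ltr_wpDl ?op_norm_ge0.
rewrite /eucl_ball /= in xa fx.
pose e := Num.min d (Num.min (r - eucl_norm (x - a))
  ((rho - eucl_norm (f x - f a)) / (op_norm (df x) + 1))).
exists e; first by rewrite !lt_min d0 subr_gt0 xa divr_gt0 // subr_gt0.
move=> y; rewrite /eucl_ball /= !lt_min => /and3P[yd yr yrho]; split.
  by apply: le_lt_trans (eucl_triangle x _ _) _; rewrite -ltrBrDr.
apply: le_lt_trans (eucl_triangle (f x) _ _) _; rewrite -ltrBrDr.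
by apply: le_lt_trans (hd y yd) _; rewrite mulrC -ltr_pdivlMr.
Qed.

(** The Lipschitz inverse of [f] maps the segments issued from [f a] to connected
    sets that all contain [a] and together make up the preimage. *)
Lemma connected_preimage (rho : R) : 0 < rho -> rho <= r / (4 * beta) ->
  connected [set x | eucl_ball a r x /\ eucl_ball (f a) rho (f x)].
Proof.
move=> rho0 rho_le; set U := [set x | _].
have ex_inv y : exists x, eucl_ball (f a) rho y -> eucl_ball a r x /\ f x = y.
  have [ya|nya] := pselect (eucl_ball (f a) rho y); last by exists a.
  by have [x xa fx] := newton_surjective rho_le ya; exists x.
have [psi psiP] := choice ex_inv.
pose p y (t : R) := f a + (t%:C)%C *: (y - f a).
have pball y t : eucl_ball (f a) rho y -> 0 <= t <= 1 -> eucl_ball (f a) rho (p y t).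
  by move=> ya t01; apply: eucl_ball_segment => //; exact: eucl_ball_center.
have psiK x : U x -> psi (f x) = x.
  move=> [xa fx]; have [pa fp] := psiP _ fx.
  apply/eqP; rewrite -subr_eq0; apply/eqP/eucl0_eq0/eqP.
  rewrite eq_le eucl_ge0 andbT; apply: le_trans (inverse_lipschitz pa xa) _.
  by rewrite fp subrr eucl0 mulr0.
have aU : U a by split; exact: eucl_ball_center.
have -> : U = \bigcup_(y in eucl_ball (f a) rho) ((psi \o p y) @` `[0, 1]).
  apply/seteqP; split=> [x Ux|x [y ya [t]]].
    exists (f x); first exact: Ux.2.
    exists 1; first by rewrite /= in_itv /= ler01 lexx.
    by rewrite /= /p scale1r addrC subrK; exact: psiK.
  rewrite /= in_itv /= => t01 <-.
  have pt := pball y t ya t01; have [pa fp] := psiP _ pt.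
  by split=> //; rewrite fp.
apply: bigcup_connected.
  exists a => y ya; exists 0; first by rewrite /= in_itv /= ler01 lexx.
  by rewrite /= /p scale0r addr0; exact: psiK.
move=> y ya; apply: connected_continuous_connected; first exact: segment_connected.
apply/subspace_continuousP => t /=; rewrite in_itv /= => t01.
move=> S /nbhs_euclP[d d0 dS].
pose L := 2 * beta * (eucl_norm (y - f a) + 1).
have L0 : 0 < L by rewrite !mulr_gt0 // ltr_wpDl ?eucl_ge0.
(* Convergence within the segment, unfolded. *)
suff : nbhs t [set s | s \in `[0, 1] -> S (psi (p y s))] by [].
apply/nbhs_ballP.
exists (d / L); first by rewrite /= divr_gt0.
move=> s; rewrite -ball_normE /= in_itv /= => ts s01; apply: dS.
rewrite /eucl_ball /=.
have [pa fp] := psiP _ (pball y s ya s01); have [pa' fp'] := psiP _ (pball y t ya t01).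
apply: le_lt_trans (inverse_lipschitz pa pa') _; rewrite fp fp'.
have -> : p y s - p y t = ((s - t)%:C)%C *: (y - f a).
  by rewrite /p opprD addrACA subrr add0r -scalerBl -rmorphB.
rewrite euclZr distrC; rewrite ltr_pdivlMr // in ts; apply: le_lt_trans ts.
rewrite mulrCA /L; apply: ler_wpM2l => //; apply: ler_wpM2l; last by rewrite lerDl.
by rewrite mulr_ge0 // ltW.
Qed.

End QuantitativeInverse.

(** The ball chosen by [derivative_doubling_ball] has [r M >= 1/4]; rescaling it by
    [r] and [f] by [r M], only [k] and [C] enter the inversion, which is why the radius
    is uniform in [f]. *)
Lemma bloch_quasiregular (R : realType) (k : nat) (C : R) : 0 < C ->
  exists2 rho : R, 0 < rho &
    forall (f : 'rV[R[i]]_k -> 'rV[R[i]]_k) (df : 'rV[R[i]]_k -> 'M[R[i]]_k),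
      holomorphic_with f df 0 1 -> 1 <= op_norm (df 0) ->
      (forall z, eucl_ball 0 1 z -> df z \in unitmx) ->
      (forall z, eucl_ball 0 1 z -> op_norm (df z) * op_norm (invmx (df z)) <= C) ->
      exists a : 'rV[R[i]]_k, exists U : set 'rV[R[i]]_k,
        [/\ domain U, U `<=` eucl_ball 0 1 & f @` U = eucl_ball a rho].
Proof.
move=> hC.
(* [tau] makes the variation of the derivative times the norm of its inverse,
   [(C / M) * (32 k M / r) * (tau r)], at most one half; [rho] is then
   [tau r / (4 beta)] with [beta = C / M] and [r M >= 1/4]. *)
pose tau : R := (64 * k%:R * C + 4)^-1.
have kC0 : 0 <= 64 * k%:R * C by rewrite !mulr_ge0 // ltW.
have tau0 : 0 < tau by rewrite invr_gt0 ltr_wpDl.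
have tau4 : tau <= 4^-1 by rewrite lef_pV2 ?posrE ?ltr_wpDl // lerDr.
have tauC : 32 * k%:R * C * tau <= 2^-1.
  rewrite ler_pdivrMr ?ltr_wpDl //.
  have -> : 2^-1 * (64 * k%:R * C + 4) = 32 * k%:R * C + 2 by field.
  by rewrite lerDl.
pose rho := tau / (16 * C).
have rho0 : 0 < rho by rewrite divr_gt0 // mulr_gt0.
exists rho => // f df f_h N0 dunit dC.
have [a [r [r0 ar rM dM]]] := derivative_doubling_ball f_h N0.
set M := op_norm (df a) in rM dM.
have M0 : 0 < M.
  by rewrite -(pmulr_rgt0 _ r0); apply: lt_le_trans rM; rewrite invr_gt0.
have a1 : eucl_ball 0 1 a by apply: ar; exact: eucl_ball_center.
pose B := invmx (df a).
have MB : M * op_norm B <= C by exact: dC.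
clearbody M.
pose beta := C / M; have beta0 : 0 < beta by rewrite divr_gt0.
have AB : df a *m B = 1%:M by apply: mulmxV; exact: dunit.
have B_le v : eucl_norm (v *m B) <= beta * eucl_norm v.
  apply: le_trans (op_normP _ _) _; apply: ler_wpM2r; first exact: eucl_ge0.
  by rewrite ler_pdivlMr // mulrC.
pose r' := tau * r; have r'0 : 0 < r' by rewrite mulr_gt0.
have r'r : r' <= r / 4 by rewrite /r' mulrC ler_pM2l.
have f_r : holomorphic_with f df a r by move=> z /ar; exact: f_h.
have sub4 : eucl_ball a r' `<=` eucl_ball a (r / 4).
  by apply: eucl_ball_sub; rewrite subrr eucl0 add0r.
have sub : eucl_ball a r' `<=` eucl_ball a r.
  move=> z /sub4; rewrite /eucl_ball /= => /lt_le_trans; apply.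
  by rewrite ler_pdivrMr // ler_peMr ?(ltW r0) // ler1n.
have f_r' : holomorphic_with f df a r' by move=> z /sub; exact: f_r.
have df_near x v : eucl_ball a r' x ->
    eucl_norm ((v *m df x - v *m df a) *m B) <= 2^-1 * eucl_norm v.
  move=> xa; apply: le_trans (B_le _) _.
  have dM' z w : eucl_ball a r z -> eucl_norm (w *m df z) <= 2 * M * eucl_norm w.
    move=> /dM dz; apply: le_trans (op_normP _ _) _.
    by apply: ler_wpM2r; first exact: eucl_ge0.
  have := derivative_lipschitz v r0 f_r dM' (sub4 _ xa).
  rewrite -(ler_pM2l beta0) => /le_trans; apply.
  have xr : eucl_norm (x - a) <= tau * r by exact: ltW.
  apply: (@le_trans _ _ (beta * (k%:R * (16 * (2 * M) / r) * eucl_norm v * (tau * r)))).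
    rewrite ler_pM2l // ler_wpM2l // mulr_ge0 ?eucl_ge0 // mulr_ge0 //.
    by rewrite divr_ge0 ?(ltW r0) // !mulr_ge0 // ltW.
  have -> : beta * (k%:R * (16 * (2 * M) / r) * eucl_norm v * (tau * r)) =
      32 * k%:R * C * tau * eucl_norm v.
    by rewrite /beta; field; rewrite !gt_eqF.
  by apply: ler_wpM2r; first exact: eucl_ge0.
have rho_le : rho <= r' / (4 * beta).
  have -> : r' / (4 * beta) = tau / (16 * C) * (4 * (r * M)).
    by rewrite /r' /beta; field; rewrite !gt_eqF.
  by rewrite ler_peMr ?(ltW rho0) // mulrC -ler_pdivrMr // mul1r.
pose U := [set x | eucl_ball a r' x /\ eucl_ball (f a) rho (f x)].
have U1 : U `<=` eucl_ball 0 1 by move=> x [/sub/ar].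
have f_image : f @` U = eucl_ball (f a) rho.
  apply/seteqP; split=> [_ [x [_ Ux] <-] //|y ya].
  have [x xa fx] := newton_surjective r'0 beta0 f_r' AB B_le df_near rho_le ya.
  by exists x => //; split=> //; rewrite fx.
exists (f a), U; split=> //; split.
- by exists a; split; exact: eucl_ball_center.
- exact: (open_preimage f_r').
- exact: (connected_preimage r'0 beta0 f_r' AB B_le df_near rho0 rho_le).
Qed.

Theorem theorem3p1 (R : realType) (k : nat) (hk : (1 < k)%N) (C : R)
    (hC : 0 < C) :
  exists2 rho : R, 0 < rho &
    forall Phi : 'rV[R[i]]_k -> 'rV[R[i]]_k,
      holomorphic_on (eucl_ball 0 1) Phi ->
      Phi 0 = 0 ->
      'J Phi 0 = 1%:M ->
      (forall z, eucl_ball 0 1 z -> 'J Phi z \in unitmx) ->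
      (forall z, eucl_ball 0 1 z ->
         op_norm ('J Phi z) * op_norm (invmx ('J Phi z)) <= C) ->
      exists a : 'rV[R[i]]_k,
        eucl_ball a rho `<=` Phi @` eucl_ball 0 1 /\
        exists U : set 'rV[R[i]]_k,
          [/\ domain U, U `<=` eucl_ball 0 1 & Phi @` U = eucl_ball a rho].
Proof.
have [rho rho0 bloch] := bloch_quasiregular k hC.
exists rho => // Phi Phi_hol _ J0 Junit JC.
have [||a [U [Udom U1 PhiU]]] := bloch Phi (fun z => 'J Phi z) _ _ Junit JC.
- by move=> z z1; apply: differentiable_frechet; exact: Phi_hol.
- by rewrite J0 op_norm1 // ltnW.
exists a; split; last by exists U.
by rewrite -PhiU => _ [x /U1 x1 <-]; exists x.
Qed.
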